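(* Let $(A,m,\sigma)$ be a braided algebra over $\mathbb{K}$, and let $\Join_\sigma$ be its quantum quasi-shuffle product on $T(A)$. Define three bilinear operations $\cdot$, $\prec$ and $\succ$ on $T^+(A)=\bigoplus_{i\ge1}A^{\otimes i}$ by: for any $a,b\in A$, any $x\in A^{\otimes i}$ and $y\in A^{\otimes j}$ ($i,j\ge0$), $$(a\otimes x)\cdot(b\otimes y)=(m\otimes\Join_{\sigma(i,j)})(\mathrm{id}_A\otimes\beta_{i,1}\otimes\mathrm{id}_A^{\otimes j})(a\otimes x\otimes b\otimes y),$$ $$(a\otimes x)\prec(b\otimes y)=a\otimes\big(x\Join_\sigma(b\otimes y)\big),$$ $$(a\otimes x)\succ(b\otimes y)=(\mathrm{id}_A\otimes\Join_{\sigma(i+1,j)})(\beta_{i+1,1}\otimes\mathrm{id}_A^{\otimes j})(a\otimes x\otimes b\otimes y).$$ Then $(T^+(A),\prec,\succ,\cdot)$ is a tridendriform algebra.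
   Context: $\mathbb{K}$ is a field of characteristic 0; all vector spaces and algebras are over $\mathbb{K}$; algebras are associative but not necessarily unital. $T(V)=\bigoplus_{i\ge 0}V^{\otimes i}$ is the tensor algebra (as a vector space); $\otimes$ is the tensor product inside $T(V)$, and $\underline{\otimes}$ is the tensor product between $T(V)$ and $T(V)$. Tridendriform algebra: a vector space $V$ with three bilinear binary operations $\prec,\succ,\cdot$ such that, with $x\ast y=x\prec y+x\succ y+x\cdot y$, for all $x,y,z\in V$: $(x\prec y)\prec z=x\prec(y\ast z)$; $(x\succ y)\prec z=x\succ(y\prec z)$; $(x\ast y)\succ z=x\succ(y\succ z)$; $(x\succ y)\cdot z=x\succ(y\cdot z)$; $(x\prec y)\cdot z=x\cdot(y\succ z)$; $(x\cdot y)\prec z=x\cdot(y\prec z)$; $(x\cdot y)\cdot z=x\cdot(y\cdot z)$. Braiding: an invertible linear map $\sigma\in\mathrm{End}(V\otimes V)$ with $(\sigma\otimes\mathrm{id}_V)(\mathrm{id}_V\otimes\sigma)(\sigma\otimes\mathrm{id}_V)=(\mathrm{id}_V\otimes\sigma)(\sigma\otimes\mathrm{id}_V)(\mathrm{id}_V\otimes\sigma)$ on $V^{\otimes 3}$. Write $\sigma_i=\mathrm{id}_V^{\otimes i-1}\otimes\sigma\otimes\mathrm{id}_V^{\otimes n-i-1}$ on $V^{\otimes n}$. For $w\in\mathfrak{S}_n$ with reduced expression $w=s_{i_1}\cdots s_{i_l}$ ($s_i$ the transposition of $i,i+1$), put $T^\sigma_w=\sigma_{i_1}\cdots\sigma_{i_l}$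 (well defined). The map $\beta:T(V)\underline{\otimes}T(V)\to T(V)\underline{\otimes}T(V)$ has restriction $\beta_{ij}=\beta_{i,j}=T^\sigma_{\chi_{ij}}$ to $V^{\otimes i}\underline{\otimes}V^{\otimes j}$ for $i,j\ge1$, where $\chi_{ij}\in\mathfrak{S}_{i+j}$ sends $k\mapsto j+k$ for $1\le k\le i$ and $i+k\mapsto k$ for $1\le k\le j$ (so $\beta_{ij}$ maps $V^{\otimes i}\underline{\otimes}V^{\otimes j}$ to $V^{\otimes j}\underline{\otimes}V^{\otimes i}$, $\beta_{11}=\sigma$); $\beta_{0i},\beta_{i0}$ are the identity of $V^{\otimes i}$. Braided algebra: a triple $(A,m,\sigma)$ with $(A,m)$ an algebra and $\sigma$ a braiding on $A$ such that $(\mathrm{id}_A\otimes m)\sigma_1\sigma_2=\sigma(m\otimes\mathrm{id}_A)$ and $(m\otimes\mathrm{id}_A)\sigma_2\sigma_1=\sigma(\mathrm{id}_A\otimes m)$. Quantum quasi-shuffle product of a braided algebra $(A,m,\sigma)$: the map $\Join_\sigma:T(A)\underline{\otimes}T(A)\to T(A)$ with $\mu\Join_\sigma x=x\Join_\sigma\mu=\mu\cdot x$ (scalar multiplication) for $\mu\in\mathbb{K}$, $x\in T(A)$, and recursively for $a_k,b_k\in A$, $i,j\ge 1$ (writing $\Join_{\sigma(i,j)}$ for the restriction to $A^{\otimes i}\underline{\otimes}A^{\otimes j}$): $(a_1\otimes\cdots\otimes a_i)\Join_\sigma(b_1\otimes\cdots\otimes b_j)=a_1\otimes\big((a_2\otimes\cdots\otimes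 a_i)\Join_\sigma(b_1\otimes\cdots\otimes b_j)\big)+(\mathrm{id}_A\otimes\Join_{\sigma(i,j-1)})(\beta_{i,1}\otimes\mathrm{id}_A^{\otimes j-1})(a_1\otimes\cdots\otimes a_i\otimes b_1\otimes\cdots\otimes b_j)+(m\otimes\Join_{\sigma(i-1,j-1)})(\mathrm{id}_A\otimes\beta_{i-1,1}\otimes\mathrm{id}_A^{\otimes j-1})(a_1\otimes\cdots\otimes a_i\otimes b_1\otimes\cdots\otimes b_j)$, where empty tensors are interpreted as $1\in\mathbb{K}$ (e.g. $a_1\Join_\sigma b_1=a_1\otimes b_1+\sigma(a_1\otimes b_1)+m(a_1\otimes b_1)$). It is known that $(T(A),\Join_\sigma)$ is an associative algebra with unit $1\in\mathbb{K}$. *)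

(* Defs.v *)
From HB Require Import structures.
From mathcomp Require Import all_boot all_order all_fingroup all_algebra.
From mathcomp Require Import boolp classical_sets.
From mathcomp Require Import finmap.
From mathcomp Require Import monalg generic_quotient.

Set Implicit Arguments.
Unset Strict Implicit.
Unset Printing Implicit Defensive.
Set Warnings "-redundant-canonical-projection".

Import GRing.Theory.
Local Open Scope ring_scope.

(* ---------------------------------------------------------------------- *)
(* The tensor algebra T(A) = \bigoplus_n A^{\otimes n} is the free module  *)
(* on words of elements of A, modulo multilinearity in every letter; the   *)
(* class of the word [:: a1; ..; an] is a1 (x) .. (x) an, that of [::] is  *)
(* 1 in K = A^{\otimes 0}. The relations preserve the length of words, so  *)
(* A^{\otimes n} is the image of the words of length n (see tpow below).   *)
(* ---------------------------------------------------------------------- *)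
Section TensorAlgebra.
Variables (K : fieldType) (A : lmodType K).
Implicit Types (a b : A) (u v w : seq A).

Definition multilinear (U : lmodType K) (phi : seq A -> U) : Prop :=
  forall (k : K) a b u v,
    phi (u ++ (k *: a + b) :: v) = k *: phi (u ++ a :: v) + phi (u ++ b :: v).

Definition mlrel (k : K) a b u v : {malg K[seq A]} :=
  << u ++ (k *: a + b) :: v >> - (k *: << u ++ a :: v >> + << u ++ b :: v >>).

Inductive mlspan : {malg K[seq A]} -> Prop :=
| mlspan0 : mlspan 0
| mlspanD c k a b u v x : mlspan x -> mlspan (c *: mlrel k a b u v + x).

Lemma mlspan_add x y : mlspan x -> mlspan y -> mlspan (x + y).
Proof.
by move=> hx hy; elim: hx => [|c k a b u v z _ ih];
  rewrite ?add0r // -addrA; constructor.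
Qed.

Lemma mlspan_scale c x : mlspan x -> mlspan (c *: x).
Proof.
elim=> [|d k a b u v z _ ih]; first by rewrite scaler0; constructor.
by rewrite scalerDr scalerA; constructor.
Qed.

Definition mlker (x : {malg K[seq A]}) : bool := `[< mlspan x >].

Lemma mlker_zmod : zmod_closed mlker.
Proof.
split=> [|x y /asboolP hx /asboolP hy]; apply/asboolP; first by constructor.
by rewrite -scaleN1r; apply: mlspan_add => //; apply: mlspan_scale.
Qed.
HB.instance Definition _ :=
  GRing.isZmodClosed.Build {malg K[seq A]} mlker mlker_zmod.

Definition tensalg : Type := Quotient.quot (GRing.ZmodClosed.clone _ mlker _).
HB.instance Definition _ := Choice.on tensalg.
HB.instance Definition _ := GRing.Zmodule.on tensalg.
HB.instance Definition _ := Quotient.on tensalg.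
HB.instance Definition _ := ZmodQuotient.on tensalg.

End TensorAlgebra.

HB.lock Definition tpi (K : fieldType) (A : lmodType K)
  (x : {malg K[seq A]}) : tensalg A := (\pi_(tensalg A) x)%qT.

HB.lock Definition tscale (K : fieldType) (A : lmodType K) (c : K)
  (x : tensalg A) : tensalg A := tpi (c *: repr x).

(* The linear map sending a1 (x) .. (x) an to phi [:: a1; ..; an]; only     *)
(* meaningful for multilinear phi (see tlift_tens, tlift_linear).          *)
HB.lock Definition tlift (K : fieldType) (A U : lmodType K) (phi : seq A -> U)
    (x : tensalg A) : U :=
  \sum_(w <- msupp (repr x)) (repr x)@_w *: phi w.

Section TensorAlgebraTheory.
Variables (K : fieldType) (A : lmodType K).
Local Notation tensalg := (tensalg A).
Implicit Types (a b : A) (u v w : seq A).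

Lemma eq_tpi (x y : {malg K[seq A]}) : (tpi x == tpi y) = mlker (x - y).
Proof.
rewrite tpi.unlock; apply/esym.
exact: (Quotient.idealrBE (GRing.ZmodClosed.clone _ (@mlker K A) _)).
Qed.

Lemma tpiD (x y : {malg K[seq A]}) : tpi (x + y) = tpi x + tpi y.
Proof. by rewrite tpi.unlock raddfD. Qed.

Lemma tpi_repr (x : tensalg) : tpi (repr x) = x.
Proof. by rewrite tpi.unlock reprK. Qed.

Lemma tpiZ c (x : {malg K[seq A]}) : tpi (c *: x) = tscale c (tpi x).
Proof.
rewrite tscale.unlock.
apply/eqP; rewrite eq_tpi -scalerBr; apply/asboolP/mlspan_scale/asboolP.
by change (mlker (x - repr (tpi x))); rewrite -eq_tpi tpi_repr.
Qed.

Lemma tscaleA c d (x : tensalg) : tscale c (tscale d x) = tscale (c * d) x.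
Proof. by rewrite -[x]tpi_repr -!tpiZ scalerA. Qed.

Lemma tscale1 (x : tensalg) : tscale 1 x = x.
Proof. by rewrite -[x]tpi_repr -tpiZ scale1r. Qed.

Lemma tscaleDr : right_distributive (@tscale K A) +%R.
Proof. by move=> c x y; rewrite -[x]tpi_repr -[y]tpi_repr -tpiD -!tpiZ scalerDr tpiD. Qed.

Lemma tscaleDl (x : tensalg) : {morph (@tscale K A)^~ x : c d / c + d}.
Proof. by move=> c d; rewrite -[x]tpi_repr -!tpiZ scalerDl tpiD. Qed.

HB.instance Definition _ := GRing.Zmodule_isLmodule.Build K tensalg
  tscaleA tscale1 tscaleDr tscaleDl.

Lemma tpi_linear : linear (@tpi K A).
Proof. by move=> c x y; rewrite tpiD tpiZ. Qed.

Definition tens w : tensalg := tpi << w >>.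

Lemma tens_multilinear : multilinear tens.
Proof.
move=> k a b u v; apply/eqP; rewrite -tpi_linear eq_tpi; apply/asboolP.
have := mlspanD 1 k a b u v (mlspan0 A).
by rewrite addr0 scale1r.
Qed.

Section Lift.
Variable U : lmodType K.
Implicit Type phi : seq A -> U.

Definition mext phi (x : {malg K[seq A]}) : U :=
  \sum_(w <- msupp x) x@_w *: phi w.

Lemma mextw phi x (D : {fset seq A}) : (msupp x `<=` D)%fset ->
  mext phi x = \sum_(w <- D) x@_w *: phi w.
Proof.
move=> sD; rewrite /mext; apply: big_fset_incl => // w _.
by move/mcoeff_outdom=> ->; rewrite scale0r.
Qed.

Lemma mext_linear phi : linear (mext phi).
Proof.
move=> c x y; pose D := (msupp (c *: x + y) `|` (msupp x `|` msupp y))%fset.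
rewrite !(@mextw _ _ D) ?scaler_sumr -?big_split /=.
- by apply: eq_bigr => w _; rewrite mcoeffD mcoeffZ scalerDl scalerA.
- by apply/fsubsetU/orP; right; exact: fsubsetUr.
- by apply/fsubsetU/orP; right; exact: fsubsetUl.
- exact: fsubsetUl.
Qed.
HB.instance Definition _ phi :=
  GRing.isLinear.Build K {malg K[seq A]} U _ (mext phi) (mext_linear phi).

Lemma mextU phi w : mext phi << w >> = phi w.
Proof.
rewrite (@mextw _ _ [fset w]%fset) ?msuppU_le // big_seq_fset1.
by rewrite mcoeffUU scale1r.
Qed.

Lemma tliftE phi (x : tensalg) : tlift phi x = mext phi (repr x).
Proof. by rewrite tlift.unlock. Qed.

Lemma tlift_tpi phi x : multilinear phi -> tlift phi (tpi x) = mext phi x.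
Proof.
move=> phiM; have ker y : mlspan y -> mext phi y = 0.
  elim=> [|c k a b u v z _ ih]; first exact: linear0.
  rewrite mext_linear ih addr0 linearB /= mext_linear !mextU phiM subrr.
  exact: scaler0.
apply/eqP; rewrite -subr_eq0 tliftE -linearB /= ker //.
by apply/asboolP; change (mlker (repr (tpi x) - x)); rewrite -eq_tpi tpi_repr.
Qed.

Lemma tlift_tens phi w : multilinear phi -> tlift phi (tens w) = phi w.
Proof. by move=> phiM; rewrite tlift_tpi // mextU. Qed.

Lemma tlift_linear phi : multilinear phi -> linear (tlift phi).
Proof.
move=> phiM c x y; rewrite -[x]tpi_repr -[y]tpi_repr -tpi_linear.
by rewrite !tlift_tpi // linearP.
Qed.

Lemma tensalg_ext (f g : tensalg -> U) : linear f -> linear g ->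
  (forall w, f (tens w) = g (tens w)) -> f =1 g.
Proof.
move=> fL gL fg x; rewrite -[x]tpi_repr [repr x]monalgE.
pose F : {linear _ -> _} := HB.pack f (GRing.isLinear.Build _ _ _ _ f fL).
pose G : {linear _ -> _} := HB.pack g (GRing.isLinear.Build _ _ _ _ g gL).
pose P : {linear _ -> _} := HB.pack (@tpi K A) (GRing.isLinear.Build _ _ _ _ (@tpi K A) tpi_linear).
rewrite -[f]/(F : _ -> _) -[g]/(G : _ -> _) -[@tpi K A]/(P : _ -> _) !linear_sum.
apply: eq_bigr => w _; rewrite (_ : << _ *g w >> = (repr x)@_w *: << w >>).
  by rewrite !linearZ /=; congr (_ *: _); exact: fg.
by apply/malgP => v; rewrite mcoeffZ !mcoeffU mulrnAr mulr1.
Qed.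
End Lift.

Section Lift2.
Variable U : lmodType K.
Implicit Type phi : seq A -> seq A -> U.

Definition tlift2 phi (x y : tensalg) : U :=
  tlift (fun u => tlift (phi u) y) x.

Lemma tlift2_multilinear phi y : (forall u, multilinear (phi u)) ->
    (forall v, multilinear (phi^~ v)) ->
  multilinear (fun u => tlift (phi u) y).
Proof.
move=> phir phil k a b u v; move: y; apply: tensalg_ext.
- exact: tlift_linear.
- move=> c x y; rewrite !tlift_linear // !scalerDr !scalerA (mulrC k).
  by rewrite -!addrA; congr (_ + _); rewrite addrCA.
- by move=> w; rewrite !tlift_tens // phil.
Qed.

Lemma tlift2_tens phi u v : (forall u, multilinear (phi u)) ->
    (forall v, multilinear (phi^~ v)) ->
  tlift2 phi (tens u) (tens v) = phi u v.
Proof.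
by move=> phir phil; rewrite /tlift2 tlift_tens ?tlift_tens //;
  exact: tlift2_multilinear.
Qed.

Lemma tlift2_bilinear phi : (forall u, multilinear (phi u)) ->
    (forall v, multilinear (phi^~ v)) ->
  bilinear_for *:%R *:%R (tlift2 phi).
Proof.
move=> phir phil; split=> [y|x] c z t; rewrite /tlift2.
  by rewrite tlift_linear //; exact: tlift2_multilinear.
move: x; apply: tensalg_ext.
- by apply: tlift_linear; exact: tlift2_multilinear.
- move=> d x y; rewrite !tlift_linear; try exact: tlift2_multilinear.
  rewrite /= !scalerDr !scalerA (mulrC c).
  by rewrite -!addrA; congr (_ + _); rewrite addrCA.
- by move=> w; rewrite !tlift_tens ?tlift_linear //; exact: tlift2_multilinear.
Qed.
End Lift2.

Definition tcat : tensalg -> tensalg -> tensalg :=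
  tlift2 (fun u v => tens (u ++ v)).

Definition tdeg (n : nat) : tensalg -> tensalg :=
  tlift (fun w => if size w == n then tens w else 0).

Lemma tens_catr u : multilinear (fun v => tens (u ++ v)).
Proof. by move=> k a b v w; rewrite !catA tens_multilinear. Qed.

Lemma tens_catl v : multilinear (fun u => tens (u ++ v)).
Proof. by move=> k a b u w; rewrite -!catA tens_multilinear. Qed.

Lemma tcat_tens u v : tcat (tens u) (tens v) = tens (u ++ v).
Proof. by apply: tlift2_tens; [exact: tens_catr|exact: tens_catl]. Qed.

Lemma tcat_bilinear : bilinear_for *:%R *:%R tcat.
Proof. by apply: tlift2_bilinear; [exact: tens_catr|exact: tens_catl]. Qed.
HB.instance Definition _ :=
  bilinear_isBilinear.Build K tensalg tensalg tensalg _ _ tcat tcat_bilinear.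

Lemma tdeg_multilinear n :
  multilinear (fun w => if size w == n then tens w else 0).
Proof.
move=> k a b u v; rewrite !size_cat /=; case: eqP => _.
  exact: tens_multilinear.
by rewrite scaler0 addr0.
Qed.

Lemma tdeg_linear n : linear (tdeg n).
Proof. exact/tlift_linear/tdeg_multilinear. Qed.
HB.instance Definition _ n :=
  GRing.isLinear.Build K tensalg tensalg _ (tdeg n) (tdeg_linear n).

Lemma tdeg_tens n w : tdeg n (tens w) = if size w == n then tens w else 0.
Proof. exact/tlift_tens/tdeg_multilinear. Qed.

Lemma tdegK n x : tdeg n (tdeg n x) = tdeg n x.
Proof.
move: x; apply: tensalg_ext; try by move=> c x y; rewrite !linearP.
by move=> w; rewrite !tdeg_tens; case: eqP => [e|_];
  rewrite ?linear0 // tdeg_tens e eqxx.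
Qed.

Lemma tdeg_cat x y : tdeg 0 (tcat x y) = tcat (tdeg 0 x) (tdeg 0 y).
Proof.
move: x; apply: tensalg_ext; try by move=> c x z; rewrite !(linearPl, linearP).
move=> u; move: y; apply: tensalg_ext; try by move=> c x z; rewrite !(linearPr, linearP).
move=> v; rewrite tcat_tens !tdeg_tens size_cat addn_eq0.
by case: eqP; case: eqP; rewrite ?linear0r ?linear0l ?tcat_tens.
Qed.

Definition homog (n : nat) : {pred tensalg} := fun x => tdeg n x == x.

Lemma homogE n x : (x \in homog n) = (tdeg n x == x).
Proof. by []. Qed.

Lemma tens_homog w : tens w \in homog (size w).
Proof. by rewrite homogE tdeg_tens !eqxx. Qed.

Lemma homog_submod n : submod_closed (homog n).
Proof.
split=> [|c x y]; rewrite !homogE; first by rewrite linear0 eqxx.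
by move=> /eqP hx /eqP hy; rewrite linearP /= hx hy eqxx.
Qed.
HB.instance Definition _ n :=
  GRing.isSubmodClosed.Build K tensalg (homog n) (homog_submod n).

Definition posdeg : {pred tensalg} := fun x => tdeg 0 x == 0.

Lemma posdegE x : (x \in posdeg) = (tdeg 0 x == 0).
Proof. by []. Qed.

Lemma posdeg_submod : submod_closed posdeg.
Proof.
split=> [|c x y]; rewrite !posdegE; first by rewrite linear0 eqxx.
by move=> /eqP hx /eqP hy; rewrite linearP /= hx hy scaler0 addr0 eqxx.
Qed.
HB.instance Definition _ :=
  GRing.isSubmodClosed.Build K tensalg posdeg posdeg_submod.

Record tpow (n : nat) := Tpow { tpow_val :> tensalg; _ : tpow_val \in homog n }.
HB.instance Definition _ n := [isSub for @tpow_val n].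
HB.instance Definition _ n := [Choice of tpow n by <:].
HB.instance Definition _ n := [SubChoice_isSubLmodule of tpow n by <:].

Record tplus := Tplus { tplus_val :> tensalg; _ : tplus_val \in posdeg }.
HB.instance Definition _ := [isSub for @tplus_val].
HB.instance Definition _ := [Choice of tplus by <:].
HB.instance Definition _ := [SubChoice_isSubLmodule of tplus by <:].

Lemma tdeg_homog n x : tdeg n x \in homog n.
Proof. by rewrite homogE tdegK. Qed.

Definition tproj n (x : tensalg) : tpow n := Tpow (tdeg_homog n x).

Lemma homog_cat p q x y : x \in homog p -> y \in homog q ->
  tcat x y \in homog (p + q).
Proof.
move=> /eqP <- /eqP <-; rewrite homogE; apply/eqP.
move: x; apply: tensalg_ext; try by move=> c x z; rewrite !(linearP, linearPl).
move=> u; move: y; apply: tensalg_ext;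
  try by move=> c x z; rewrite !(linearP, linearPr).
move=> v; rewrite !tdeg_tens; case: eqP => [<-|_]; last by rewrite !linear0l linear0.
case: eqP => [<-|_]; last by rewrite !linear0r linear0.
by rewrite tcat_tens tdeg_tens size_cat eqxx.
Qed.

Lemma tcatA : associative tcat.
Proof.
move=> x y z; move: x; apply: tensalg_ext; try by move=> c x t; rewrite !linearPl.
move=> u; move: y; apply: tensalg_ext; try by move=> c x t; rewrite !(linearPl, linearPr).
move=> v; move: z; apply: tensalg_ext; try by move=> c x t; rewrite !linearPr.
by move=> w; rewrite !tcat_tens catA.
Qed.

(* f \otimes g, splitting a tensor after its first p letters. *)
Definition tmap (p : nat) (f g : tensalg -> tensalg) : tensalg -> tensalg :=
  tlift (fun w => tcat (f (tens (take p w))) (g (tens (drop p w)))).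

Lemma tmap_multilinear p f g : linear f -> linear g ->
  multilinear (fun w => tcat (f (tens (take p w))) (g (tens (drop p w)))).
Proof.
move=> fL gL k a b u v; case: (leqP p (size u)) => [le_pu|lt_up].
  rewrite !take_cat !drop_cat; case: ltnP => [_|le_up].
    by rewrite tens_multilinear gL linearPr.
  have -> : (p - size u = 0)%N by apply/eqP; rewrite subn_eq0.
  by have /= tM := tens_multilinear k a b [::] v;
    rewrite ?take0 ?cats0 ?drop0 tM gL linearPr.
have [r ->] : exists r, p = (size u + r.+1)%N.
  by exists (p - (size u).+1)%N; rewrite -addSnnS subnKC.
rewrite !take_cat !drop_cat !ltnNge !leq_addr !addKn /=.
by rewrite tens_multilinear fL linearPl.
Qed.

Lemma tmap_linear p f g : linear f -> linear g -> linear (tmap p f g).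
Proof. by move=> fL gL; apply/tlift_linear/tmap_multilinear. Qed.

Lemma tmap_cat p f g x y : linear f -> linear g -> x \in homog p ->
  tmap p f g (tcat x y) = tcat (f x) (g y).
Proof.
move=> fL gL /eqP <-.
move: x; apply: tensalg_ext.
- by move=> c x z; rewrite linearP linearPl tmap_linear.
- by move=> c x z; rewrite linearP fL linearPl.
move=> u; move: y; apply: tensalg_ext.
- by move=> c x z; rewrite linearPr tmap_linear.
- by move=> c x z; rewrite gL linearPr.
move=> v; rewrite tdeg_tens; case: eqP => [su|_].
  rewrite tcat_tens /tmap tlift_tens; last exact: tmap_multilinear.
  by rewrite (take_size_cat _ su) (drop_size_cat _ su).
have f0 : f 0 = 0 by have := fL (-1) 0 0; rewrite scaler0 addr0 scaleN1r addNr.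
rewrite f0 !linear0l; have := @tmap_linear p _ _ fL gL (-1) 0 0.
by rewrite scaler0 addr0 scaleN1r addNr.
Qed.
End TensorAlgebraTheory.

Arguments homog {K} A n _.
Arguments posdeg {K} A _.

Section ReducedExpressions.
Variable n : nat.

Lemma adj_lt1 (i : 'I_n.-1) : (i < n)%N.
Proof. exact: leq_trans (ltn_ord i) (leq_pred n). Qed.

Lemma adj_lt2 (i : 'I_n.-1) : (i.+1 < n)%N.
Proof. by rewrite -ltn_predRL. Qed.

(* With 0-based positions, i stands for the transposition s_{i+1} of the   *)
(* (i+1)-st and (i+2)-nd letters.                                          *)
Definition adj_tperm (i : 'I_n.-1) : 'S_n :=
  tperm (Ordinal (adj_lt1 i)) (Ordinal (adj_lt2 i)).

(* Products of permutations are read as compositions of maps, so that      *)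
(* [:: i1; ..; il] denotes s_{i1} \o .. \o s_{il}; the group law of 'S_n   *)
(* in the library composes in the opposite order.                          *)
Definition expr_perm (l : seq 'I_n.-1) : 'S_n :=
  foldr (fun i w => (w * adj_tperm i)%g) 1%g l.

Definition reduced_expr (w : 'S_n) (l : seq 'I_n.-1) : Prop :=
  expr_perm l = w /\
  forall l', expr_perm l' = w -> (size l <= size l')%N.

End ReducedExpressions.

Definition chi_fun (i j : nat) (k : 'I_(i + j)) : 'I_(i + j) :=
  cast_ord (addnC j i)
    (match split k with inl k1 => rshift j k1 | inr k2 => lshift i k2 end).

Lemma chi_inj i j : injective (@chi_fun i j).
Proof.
move=> k l /cast_ord_inj; rewrite -{2}(splitK k) -{2}(splitK l).
case: (split k) => k1; case: (split l) => l1 /=.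
- by move/rshift_inj->.
- by move/eqP; rewrite eq_rlshift.
- by move/eqP; rewrite eq_lrshift.
- by move/lshift_inj->.
Qed.

Definition chi i j : 'S_(i + j) := perm (@chi_inj i j).

Section QuasiShuffle.
Variables (K : fieldType) (A : lmodType K).
Variables (m : {bilinear A -> A -> A}) (s : {linear tpow A 2 -> tpow A 2}).
Local Notation T := (tensalg A).

(* Throughout, a map defined on A^{\otimes p} is extended by 0 to the      *)
(* other components of T(A); in particular tdeg p is id on A^{\otimes p}.  *)
Definition sigma2 (x : T) : T := s (tproj 2 x).

Definition mul2 : T -> T :=
  tlift (fun w => if w is [:: a; b] then tens [:: m a b] else 0).

Definition sigma (n i : nat) : T -> T :=
  tmap i.-1 (tdeg i.-1) (tmap 2 sigma2 (tdeg (n - i - 1))).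

(* T^sigma_w; by the braid relation it does not depend on which reduced    *)
(* expression of w is chosen.                                              *)
Definition sigma_perm (n : nat) (w : 'S_n) : T -> T :=
  foldr (fun (i : 'I_n.-1) f => sigma n i.+1 \o f) (tdeg n)
    (xget [::] [set l | reduced_expr w l]%classic).

Definition beta (i j : nat) : T -> T :=
  if (i == 0)%N || (j == 0)%N then tdeg (i + j) else sigma_perm (chi i j).

Definition braiding : Prop :=
  bijective s /\
  forall x : tpow A 3,
    sigma 3 1 (sigma 3 2 (sigma 3 1 x)) = sigma 3 2 (sigma 3 1 (sigma 3 2 x)).

Definition braided_algebra : Prop :=
  [/\ associative m, braiding,
      forall x : tpow A 3,
        tmap 1 (tdeg 1) mul2 (sigma 3 1 (sigma 3 2 x)) =
        sigma2 (tmap 2 mul2 (tdeg 1) x) &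
      forall x : tpow A 3,
        tmap 2 mul2 (tdeg 1) (sigma 3 2 (sigma 3 1 x)) =
        sigma2 (tmap 1 (tdeg 1) mul2 x)].

(* The restriction of the quasi-shuffle product to the pair (i, j), as a   *)
(* map on A^{\otimes i} \otimes A^{\otimes j} = A^{\otimes (i + j)}.       *)
Fixpoint qsh (i : nat) : nat -> T -> T :=
  match i with
  | 0 => fun j => tdeg j
  | i'.+1 => fix qsh_i (j : nat) : T -> T :=
      match j with
      | 0 => tdeg i
      | j'.+1 => fun x =>
          tmap 1 (tdeg 1) (qsh i' j) x
          + tmap 1 (tdeg 1) (qsh_i j') (tmap i.+1 (beta i 1) (tdeg j') x)
          + tmap 2 mul2 (qsh i' j')
              (tmap 1 (tdeg 1) (tmap i (beta i' 1) (tdeg j')) x)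
      end
  end.

(* The bilinear operation on T(A) given on A^{\otimes p} x A^{\otimes q}   *)
(* by (x, y) |-> G p q (x \otimes y).                                      *)
Definition blockop (G : nat -> nat -> T -> T) : T -> T -> T :=
  tlift2 (fun u v => G (size u) (size v) (tens (u ++ v))).

Definition qshuffle : T -> T -> T := blockop qsh.

(* For the operations on T^+(A), with p = i + 1 and q = j + 1; see qdotE,  *)
(* qprecE and qsuccE for the formulas on (a \otimes x, b \otimes y).       *)
Definition dot_block (p q : nat) : T -> T :=
  match p, q with
  | i.+1, j.+1 => fun x =>
      tmap 2 mul2 (qsh i j)
        (tmap 1 (tdeg 1) (tmap i.+1 (beta i 1) (tdeg j)) x)
  | _, _ => fun=> 0
  end.

Definition prec_block (p q : nat) : T -> T :=
  match p, q with
  | i.+1, j.+1 => tmap 1 (tdeg 1) (qsh i j.+1)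
  | _, _ => fun=> 0
  end.

Definition succ_block (p q : nat) : T -> T :=
  match p, q with
  | i.+1, j.+1 => fun x =>
      tmap 1 (tdeg 1) (qsh i.+1 j) (tmap i.+2 (beta i.+1 1) (tdeg j) x)
  | _, _ => fun=> 0
  end.

Lemma tlift_posdeg (phi : seq A -> T) x : (forall w, phi w \in posdeg A) ->
  tlift phi x \in posdeg A.
Proof. by move=> h; rewrite tliftE; apply: rpred_sum => w _; apply/rpredZ/h. Qed.

Lemma tcat_posdeg (x y : T) : x \in posdeg A -> tcat x y \in posdeg A.
Proof. by rewrite !posdegE tdeg_cat => /eqP->; rewrite linear0l. Qed.

Lemma tmap_posdeg p (f g : T -> T) x : (forall z, f z \in posdeg A) ->
  tmap p f g x \in posdeg A.
Proof. by move=> h; apply: tlift_posdeg => w; exact: tcat_posdeg. Qed.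

Lemma tens_posdeg (w : seq A) : w != [::] -> tens w \in posdeg A.
Proof. by case: w => // a w _; rewrite posdegE tdeg_tens. Qed.

Lemma tdeg1_posdeg x : tdeg 1 x \in posdeg A.
Proof.
apply: tlift_posdeg => -[|a [|b w]] /=; rewrite ?rpred0 //.
exact: tens_posdeg.
Qed.

Lemma mul2_posdeg x : mul2 x \in posdeg A.
Proof.
apply: tlift_posdeg => -[|a [|b [|c w]]] /=; rewrite ?rpred0 //.
exact: tens_posdeg.
Qed.

Lemma blockop_posdeg G x y : (forall p q z, G p q z \in posdeg A) ->
  blockop G x y \in posdeg A.
Proof. by move=> h; do 2!apply: tlift_posdeg => ?; exact: h. Qed.

Lemma dot_posdeg x y : blockop dot_block x y \in posdeg A.
Proof.
apply: blockop_posdeg => -[|p] [|q] z; rewrite /= ?rpred0 //.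
exact/tmap_posdeg/mul2_posdeg.
Qed.

Lemma prec_posdeg x y : blockop prec_block x y \in posdeg A.
Proof.
apply: blockop_posdeg => -[|p] [|q] z; rewrite /= ?rpred0 //.
exact/tmap_posdeg/tdeg1_posdeg.
Qed.

Lemma succ_posdeg x y : blockop succ_block x y \in posdeg A.
Proof.
apply: blockop_posdeg => -[|p] [|q] z; rewrite /= ?rpred0 //.
exact/tmap_posdeg/tdeg1_posdeg.
Qed.

Definition qdot (x y : tplus A) : tplus A := Tplus (dot_posdeg x y).
Definition qprec (x y : tplus A) : tplus A := Tplus (prec_posdeg x y).
Definition qsucc (x y : tplus A) : tplus A := Tplus (succ_posdeg x y).

Lemma sigma2_linear : linear sigma2.
Proof.
move=> c x y; rewrite /sigma2.
have -> : tproj 2 (c *: x + y) = c *: tproj 2 x + tproj 2 y.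
  by apply: val_inj; rewrite /= linearP.
by rewrite linearP.
Qed.

Lemma mul2_linear : linear mul2.
Proof.
apply: tlift_linear => k a b [|c [|d u]] v /=.
- case: v => [|e [|f v]]; rewrite ?scaler0 ?addr0 // linearPl.
  exact: (tens_multilinear k _ _ [::] [::]).
- case: v => [|e v]; rewrite ?scaler0 ?addr0 // linearPr.
  exact: (tens_multilinear k _ _ [::] [::]).
- by case: u => [|? ?]; rewrite scaler0 addr0.
Qed.

Lemma sigma_linear n i : linear (sigma n i).
Proof.
apply: tmap_linear; first exact: tdeg_linear.
by apply: tmap_linear; [exact: sigma2_linear|exact: tdeg_linear].
Qed.

Lemma beta_linear i j : linear (beta i j).
Proof.
rewrite /beta; case: ifP => _; first exact: tdeg_linear.
rewrite /sigma_perm; elim: (xget _ _) => [|k l ih] /=; first exact: tdeg_linear.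
by move=> c x y /=; rewrite ih sigma_linear.
Qed.

Lemma tmap_beta_linear p i j : linear (tmap p (beta i 1) (@tdeg _ A j)).
Proof. by apply: tmap_linear; [exact: beta_linear|exact: tdeg_linear]. Qed.

Lemma qshSS i j x : qsh i.+1 j.+1 x =
  tmap 1 (tdeg 1) (qsh i j.+1) x
  + tmap 1 (tdeg 1) (qsh i.+1 j) (tmap i.+2 (beta i.+1 1) (tdeg j) x)
  + tmap 2 mul2 (qsh i j) (tmap 1 (tdeg 1) (tmap i.+1 (beta i 1) (tdeg j)) x).
Proof. by []. Qed.

Lemma qsh_linear i j : linear (qsh i j).
Proof.
elim: i j => [|i ihi] j; first exact: tdeg_linear.
elim: j => [|j ihj] c x y; first exact: tdeg_linear.
have l1 g : linear g -> linear (tmap 1 (@tdeg _ A 1) g).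
  by apply: tmap_linear; exact: tdeg_linear.
rewrite !qshSS (tmap_beta_linear i.+2) (l1 _ (ihi j.+1)) (l1 _ ihj).
rewrite (l1 _ (tmap_beta_linear _ _ _)) (tmap_linear 2 mul2_linear (ihi j)).
by rewrite !scalerDr [X in X + _ = _]addrACA [LHS]addrACA.
Qed.

Lemma blockop_homog G p q x y : (forall p q, linear (G p q)) ->
  x \in homog A p -> y \in homog A q -> blockop G x y = G p q (tcat x y).
Proof.
move=> GL /eqP <- /eqP <-.
have phir u : multilinear (fun v => G (size u) (size v) (tens (u ++ v))).
  by move=> k a b v w; rewrite !size_cat !catA tens_multilinear GL.
have phil v : multilinear (fun u => G (size u) (size v) (tens (u ++ v))).
  by move=> k a b u w; rewrite !size_cat -!catA tens_multilinear GL.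
have [bl br] := tlift2_bilinear phir phil.
have Bl c x1 x2 y1 : blockop G (c *: x1 + x2) y1 =
    c *: blockop G x1 y1 + blockop G x2 y1 by exact: bl.
have Br c x1 y1 y2 : blockop G x1 (c *: y1 + y2) =
    c *: blockop G x1 y1 + blockop G x1 y2 by exact: br.
have G0 k l : G k l 0 = 0.
  by have := GL k l (-1) 0 0; rewrite scaler0 addr0 scaleN1r addNr.
move: x; apply: tensalg_ext => [c x z|c x z|u].
- by rewrite tdeg_linear Bl.
- by rewrite tdeg_linear linearPl GL.
move: y; apply: tensalg_ext => [c x z|c x z|v].
- by rewrite tdeg_linear Br.
- by rewrite tdeg_linear linearPr GL.
rewrite !tdeg_tens; case: eqP => [<-|_]; last first.
  rewrite linear0l G0; have := Bl (-1) 0 0 (if size v == q then tens v else 0).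
  by rewrite scaler0 addr0 scaleN1r addNr.
case: eqP => [<-|_]; first by rewrite tcat_tens /blockop tlift2_tens.
rewrite linear0r G0; have := Br (-1) (tens u) 0 0.
by rewrite scaler0 addr0 scaleN1r addNr.
Qed.

Definition tcons (a : A) (x : T) : tplus A :=
  Tplus (tcat_posdeg x (@tens_posdeg [:: a] isT)).

Lemma tcons_homog a i x : x \in homog A i -> (tcons a x : T) \in homog A i.+1.
Proof. by move=> xi; exact: (homog_cat (tens_homog [:: a]) xi). Qed.

Lemma zero_linear : linear (fun _ : T => 0 : T).
Proof. by move=> c x y; rewrite scaler0 addr0. Qed.

Lemma dot_block_linear p q : linear (dot_block p q).
Proof.
case: p q => [|i] [|j]; try exact: zero_linear.
have l1 := tmap_linear 1 (@tdeg_linear _ A 1) (tmap_beta_linear i.+1 i j).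
move=> c x y; rewrite /= l1.
by apply: tmap_linear; [exact: mul2_linear|exact: qsh_linear].
Qed.

Lemma prec_block_linear p q : linear (prec_block p q).
Proof.
case: p q => [|i] [|j]; try exact: zero_linear.
by apply: tmap_linear; [exact: tdeg_linear|exact: qsh_linear].
Qed.

Lemma succ_block_linear p q : linear (succ_block p q).
Proof.
case: p q => [|i] [|j]; try exact: zero_linear.
move=> c x y; rewrite /= tmap_beta_linear.
by apply: tmap_linear; [exact: tdeg_linear|exact: (qsh_linear i.+1)].
Qed.

Lemma qdotE a b x y i j : x \in homog A i -> y \in homog A j ->
  qdot (tcons a x) (tcons b y) =
  tmap 2 mul2 (qsh i j) (tmap 1 (tdeg 1) (tmap i.+1 (beta i 1) (tdeg j))
    (tcat (tcat (tens [:: a]) x) (tcat (tens [:: b]) y))) :> T.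
Proof.
move=> /(tcons_homog a) xi /(tcons_homog b) yj.
exact: (blockop_homog dot_block_linear xi yj).
Qed.

Lemma qprecE a b x y i j : x \in homog A i -> y \in homog A j ->
  qprec (tcons a x) (tcons b y) =
  tcat (tens [:: a]) (qshuffle x (tcat (tens [:: b]) y)) :> T.
Proof.
move=> xi yj; have axi := tcons_homog a xi; have byj := tcons_homog b yj.
have aE : tens [:: a] \in homog A 1 by exact: (tens_homog [:: a]).
rewrite [LHS](blockop_homog prec_block_linear axi byj).
rewrite /qshuffle (blockop_homog qsh_linear xi byj) -tcatA.
rewrite [LHS]tmap_cat //; [|exact: tdeg_linear|exact: qsh_linear].
by move: aE; rewrite homogE => /eqP->.
Qed.

Lemma qsuccE a b x y i j : x \in homog A i -> y \in homog A j ->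
  qsucc (tcons a x) (tcons b y) =
  tmap 1 (tdeg 1) (qsh i.+1 j) (tmap i.+2 (beta i.+1 1) (tdeg j)
    (tcat (tcat (tens [:: a]) x) (tcat (tens [:: b]) y))) :> T.
Proof.
move=> /(tcons_homog a) xi /(tcons_homog b) yj.
exact: (blockop_homog succ_block_linear xi yj).
Qed.

End QuasiShuffle.

Section Tridendriform.
Variables (K : fieldType) (V : lmodType K) (prec succ dot : V -> V -> V).
Local Notation "x ≺ y" := (prec x y) (at level 40).
Local Notation "x ≻ y" := (succ x y) (at level 40).
Local Notation "x ⋅ y" := (dot x y) (at level 40).
Local Notation "x ∗ y" := (x ≺ y + x ≻ y + x ⋅ y) (at level 40).

Record tridendriform : Prop := {
  tridend_prec_bilinear : bilinear_for *:%R *:%R prec;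
  tridend_succ_bilinear : bilinear_for *:%R *:%R succ;
  tridend_dot_bilinear : bilinear_for *:%R *:%R dot;
  tridend1 : forall x y z, (x ≺ y) ≺ z = x ≺ (y ∗ z);
  tridend2 : forall x y z, (x ≻ y) ≺ z = x ≻ (y ≺ z);
  tridend3 : forall x y z, (x ∗ y) ≻ z = x ≻ (y ≻ z);
  tridend4 : forall x y z, (x ≻ y) ⋅ z = x ≻ (y ⋅ z);
  tridend5 : forall x y z, (x ≺ y) ⋅ z = x ⋅ (y ≻ z);
  tridend6 : forall x y z, (x ⋅ y) ≺ z = x ⋅ (y ≺ z);
  tridend7 : forall x y z, (x ⋅ y) ⋅ z = x ⋅ (y ⋅ z)
}.

End Tridendriform.

(* Main.v *)
(* Write R y, S y, D y for the right operators x |-> x * y (quasi-shuffle),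
   x |-> x > y and x |-> x . y, and put 1 (x) f for the action of f behind the
   first letter. On T^+ one has x < y = (1 (x) R y) x and
   D y = m_12 (1 (x) S y), while S (b (x) y) = (1 (x) R y) beta_b, where beta_b
   braids the letter b to the front through a tensor. So the seven axioms reduce
   to the associativity R z (R y) = R (R z y) and to three ways in which beta_b
   commutes with the structure maps:
     beta_{m(b, c)} = m_12 (1 (x) beta_c) beta_b      (braided algebra axiom),
     (1 (x) beta_c) beta_b intertwines sigma          (braid relation),
     beta_c (R y x) = S (beta_c y) x,
   the last one by induction on both arguments; associativity then follows by
   induction on the three lengths, each axiom for shorter words giving one of
   the seven summands of R z (R y x). *)

From HB Require Import structures.
Require Import Defs.
From mathcomp Require Import all_boot all_order all_algebra.
From mathcomp Require Import all_fingroup zify.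
From mathcomp Require classical_sets.

Set Implicit Arguments.
Unset Strict Implicit.
Unset Printing Implicit Defensive.

Import GRing.Theory.

(** * The unique reduced expression of [chi n 1] *)

Lemma adj_tpermE n (i : 'I_n.-1) (x : 'I_n) :
  adj_tperm i x = (if x == i :> nat then i.+1
    else if x == i.+1 :> nat then (i : nat) else x) :> nat.
Proof.
rewrite /adj_tperm; case: tpermP => [->|->|/eqP + /eqP] /=; first by rewrite eqxx.
  by rewrite eqxx ifN // neq_ltn ltnSn orbT.
by rewrite -!val_eqE /= => /negbTE-> /negbTE->.
Qed.

(* Every letter moves a point by at most one position, so a word taking the last
   point to 0 in the minimal number of steps is forced; this makes the reduced
   expression of chi n 1 unique. *)
Lemma expr_perm_size n (l : seq 'I_n.-1) (x : 'I_n) :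
  (x <= expr_perm l x + size l) /\
  (x = expr_perm l x + size l :> nat -> map val l = iota (expr_perm l x) (size l)).
Proof.
elim: l => [|i l [le_x eq_x]] /=; first by rewrite perm1 addn0.
rewrite permM adj_tpermE; set y := expr_perm l x in le_x eq_x *.
split=> [|xE]; first by clear eq_x; case: eqP => [|_]; [|case: eqP]; lia.
(* Equality leaves no slack, so the letter [i] must lower [y] by one. *)
have yE : y = i.+1 :> nat.
  by clear eq_x; move: xE; case: eqP => [|_]; [|case: eqP]; lia.
move: xE eq_x; rewrite yE eqxx ifN ?(gtn_eqF (ltnSn i)) // => xE -> //.
by lia.
Qed.

(** A run of consecutive letters is a cycle. The last letter acts first, so the point [p + size l]
    is carried down by every letter in turn, while each other point of the run is raised by exactly
    one letter. *)
Lemma expr_perm_iota n p (l : seq 'I_n.-1) (x : 'I_n) :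
  map val l = iota p (size l) -> x <= p + size l ->
  expr_perm l x = (if x == p + size l :> nat then p
     else if p <= x then x.+1 else x) :> nat.
Proof.
elim: l p => [|i l ih] p /=; first
  by rewrite perm1; do ![case: eqP => ? /=]; do ?[case: leqP => ? /=]; lia.
case=> ip /(ih p.+1) {}ih le_x; rewrite permM adj_tpermE ih; last by lia.
have {}ip : i = p :> nat := ip.
rewrite ip addSnnS; case: (x =P _ :> nat) => ?.
  by rewrite ifN ?eqxx; lia.
by case: (ltnP p x) => ?; do ?[case: eqP => ?]; do ?[case: leqP => ?]; lia.
Qed.

Lemma chi_last n : chi n 1 (rshift n ord0) = 0 :> nat.
Proof. by rewrite permE /chi_fun (unsplitK (inr _)). Qed.

Lemma chi_first n (k : 'I_n) : chi n 1 (lshift 1 k) = k.+1 :> nat.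
Proof. by rewrite permE /chi_fun (unsplitK (inl _)). Qed.

Lemma iota_ord n k : k <= n -> {l : seq 'I_n | map val l = iota 0 k}.
Proof.
move=> le_kn; exists (map (widen_ord le_kn) (enum 'I_k)).
by rewrite -map_comp -val_enum_ord; apply: eq_map.
Qed.

(** Taking the last point to 0 costs at least n letters, and the run 0, ..., n - 1 does it with n
    while giving [chi n 1]. A reduced word thus has exactly n letters, and then the equality case of
    [expr_perm_size] determines it. Hence the choice made by [sigma_perm] is forced for
    [chi n 1]. *)
Lemma reduced_expr_chi n (l : seq 'I_(n + 1).-1) :
  reduced_expr (chi n 1) l <-> map val l = iota 0 n.
Proof.
have chi_size l' : expr_perm l' = chi n 1 ->
    n <= size l' /\ (size l' = n -> map val l' = iota 0 n).
  move=> l'E; have := expr_perm_size l' (rshift n ord0).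
  by rewrite l'E chi_last !add0n /= addn0 => -[? h]; split=> // e; rewrite h ?e.
have size_iota (k : seq 'I_(n + 1).-1) : map val k = iota 0 n -> size k = n.
  by move/(congr1 size); rewrite size_map seq.size_iota.
have iota_chi (k : seq 'I_(n + 1).-1) : map val k = iota 0 n -> expr_perm k = chi n 1.
  move=> kE; have sk := size_iota _ kE; apply/permP => x; apply: val_inj => /=.
  rewrite (@expr_perm_iota _ 0) ?sk // ?add0n; last by have := ltn_ord x; lia.
  rewrite -(splitK x); case: (split x) => y /=.
    by rewrite chi_first ltn_eqF.
  by rewrite (ord1 y) chi_last addn0 eqxx.
split=> [[lE min_l]|lE]; last first.
  split=> [|l' l'E]; first exact: iota_chi.
  by rewrite (size_iota _ lE); case: (chi_size _ l'E).
have [ge_n] := chi_size _ lE; apply; apply/eqP; rewrite eqn_leq ge_n andbT.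
have [k kE] : {k : seq 'I_(n + 1).-1 | map val k = iota 0 n}.
  by apply: iota_ord; rewrite addn1.
by rewrite (leq_trans (min_l k (iota_chi k kE))) // (size_iota k kE).
Qed.

Local Open Scope ring_scope.

Lemma beta1E (K : fieldType) (A : lmodType K) (s : {linear tpow A 2 -> tpow A 2}) n :
  (0 < n)%N -> beta s n 1 =
    foldr (fun i f => sigma s (n + 1) i.+1 \o f) (@tdeg K A (n + 1)) (iota 0 n).
Proof.
move=> n_gt0; rewrite /beta gtn_eqF //= /sigma_perm.
set l := classical_sets.xget _ _.
have <- : map val l = iota 0 n.
  (* The default value of [xget] would occur only if there were no reduced expression; the run 0,
     ..., n - 1 is one. *)
  apply/reduced_expr_chi; rewrite /l; case: classical_sets.xgetP => [k -> //|] /= noex.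
  have [k kE] : {k : seq 'I_(n + 1).-1 | map val k = iota 0 n}.
    by apply: iota_ord; rewrite addn1.
  by case: (noex k); apply/reduced_expr_chi.
by elim: l => //= i l ->.
Qed.

Lemma linear_fun0 (K : fieldType) (U V : lmodType K) (f : U -> V) :
  linear f -> f 0 = 0.
Proof. by move=> fL; have := fL (-1) 0 0; rewrite scaler0 addr0 scaleN1r addNr. Qed.

Lemma linear_add (K : fieldType) (U V : lmodType K) (f g : U -> V) :
  linear f -> linear g -> linear (fun u => f u + g u).
Proof. by move=> fL gL k u v; rewrite fL gL scalerDr addrACA. Qed.

(** * Tensors letter by letter: extension principles and operators near the first letters *)

Section Words.
Variables (K : fieldType) (A : lmodType K).
Local Notation T := (tensalg A).
Local Notation tone := (tens [::] : T).
Implicit Types (a b c : A) (x y z : T) (U : lmodType K).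

Definition lcons a x : T := tcat (tens [:: a]) x.

Lemma tens_cons a w : tens (a :: w) = lcons a (tens w).
Proof. by rewrite /lcons tcat_tens. Qed.

Lemma lcons_bilinear : bilinear_for *:%R *:%R lcons.
Proof.
split=> [x k a b|a k x y]; rewrite /lcons; last exact: linearPr.
by rewrite (tens_multilinear k a b [::] [::]) linearPl.
Qed.
HB.instance Definition _ := bilinear_isBilinear.Build K A T T _ _ lcons lcons_bilinear.
Lemma lcons_linear a : linear (lcons a).
Proof. by move=> k x y; rewrite linearPr. Qed.
HB.instance Definition _ a := GRing.isLinear.Build K T T _ (lcons a) (lcons_linear a).

Lemma tcat1l x : tcat tone x = x.
Proof.
move: x; apply: tensalg_ext => [k x y|//|w]; first by rewrite linearPr.
by rewrite tcat_tens.
Qed.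

Lemma tcat1r x : tcat x tone = x.
Proof.
move: x; apply: tensalg_ext => [k x y|//|w]; first by rewrite linearPl.
by rewrite tcat_tens cats0.
Qed.

Lemma tcat_consl a x y : tcat (lcons a x) y = lcons a (tcat x y).
Proof. by rewrite /lcons tcatA. Qed.

Lemma tcons_ext U (f g : T -> U) : linear f -> linear g -> f tone = g tone ->
  (forall a x, f (lcons a x) = g (lcons a x)) -> f =1 g.
Proof. by move=> fL gL fg1 fg; apply: tensalg_ext => // -[|a w] //; rewrite tens_cons. Qed.

Lemma tcons2_ext U (f g : T -> U) : linear f -> linear g ->
    (forall w, (size w < 2)%N -> f (tens w) = g (tens w)) ->
    (forall a b x, f (lcons a (lcons b x)) = g (lcons a (lcons b x))) ->
  f =1 g.
Proof.
move=> fL gL fg1 fg; apply: tensalg_ext => // -[|a [|b w]]; try exact: fg1.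
by rewrite !tens_cons.
Qed.

(** Elements of T^+ are given by a vanishing degree 0 part, not as sums of words. So z |-> f z - f
    (z_0), with z_0 the scalar part of z, is compared with its analogue for g on all words: both are
    0 on the empty word, and the correction vanishes on T^+. *)
Lemma posdeg_ext U (f g : T -> U) : linear f -> linear g ->
  (forall a x, f (lcons a x) = g (lcons a x)) -> {in posdeg A, f =1 g}.
Proof.
move=> fL gL fg x; rewrite posdegE => /eqP x0.
have f0 := linear_fun0 fL.
have g0 := linear_fun0 gL.
have fgE z : f z - f (tdeg 0 z) = g z - g (tdeg 0 z).
  move: z; apply: tensalg_ext => [k u v|k u v|[|a w]].
  - by rewrite tdeg_linear !fL opprD addrACA scalerBr.
  - by rewrite tdeg_linear !gL opprD addrACA scalerBr.
  - by rewrite tdeg_tens eqxx !subrr.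
  - by rewrite tdeg_tens f0 g0 !subr0 tens_cons.
by have := fgE x; rewrite x0 f0 g0 !subr0.
Qed.

(** The universal property of T^+ = A (x) T(A): the linear map induced by a bilinear [G], extended
    by 0 to the scalars. *)
Definition uncons U (G : A -> T -> U) : T -> U :=
  tlift (fun w => if w is a :: u then G a (tens u) else 0).

Section Uncons.
Variables (U : lmodType K) (G : A -> T -> U).
Hypothesis Gbil : bilinear_for *:%R *:%R G.

Lemma uncons_multilinear :
  multilinear (fun w => if w is a :: u then G a (tens u) else 0).
Proof.
move=> k a b [|c u] v /=; first exact: Gbil.1.
by rewrite tens_multilinear; exact: Gbil.2.
Qed.

Lemma uncons_linear : linear (uncons G).
Proof. exact/tlift_linear/uncons_multilinear. Qed.

Lemma uncons1 : uncons G tone = 0.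
Proof. exact/tlift_tens/uncons_multilinear. Qed.

Lemma uncons_cons a x : uncons G (lcons a x) = G a x.
Proof.
move: x; apply: tensalg_ext => [k x y|k x y|w].
- by rewrite linearPr uncons_linear.
- exact: Gbil.2.
by rewrite -tens_cons /uncons tlift_tens //; exact: uncons_multilinear.
Qed.
End Uncons.

(* 1 (x) f on T^+; it vanishes on scalars. *)
Definition tlmap (f : {linear T -> T}) : T -> T := tmap 1 (@tdeg K A 1) f.

Lemma tlmap_linear f : linear (tlmap f).
Proof. by apply: tmap_linear; exact: linearP. Qed.
HB.instance Definition _ f := GRing.isLinear.Build K T T _ (tlmap f) (tlmap_linear f).

Lemma tlmap_cons f a x : tlmap f (lcons a x) = lcons a (f x).
Proof.
rewrite /tlmap tmap_cat; [|exact: linearP|exact: linearP|exact: (tens_homog [:: a])].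
by rewrite tdeg_tens.
Qed.

Lemma tlmap_one f : tlmap f tone = 0.
Proof.
rewrite /tlmap /tmap tlift_tens ?tdeg_tens ?linear0l //.
by apply: tmap_multilinear; exact: linearP.
Qed.

Lemma eq_tlmap (f g : {linear T -> T}) : f =1 g -> tlmap f =1 tlmap g.
Proof.
move=> fg; apply: tcons_ext => [||| a x]; try exact: linearP.
  by rewrite !tlmap_one.
by rewrite !tlmap_cons fg.
Qed.

(** Linearity of f |-> 1 (x) f, phrased pointwise because it is applied to families [F y] of bundled
    linear maps depending linearly on [y]. *)
Lemma tlmap_lin k (f g h : {linear T -> T}) : (forall x, h x = k *: f x + g x) ->
  forall x, tlmap h x = k *: tlmap f x + tlmap g x.
Proof.
move=> hE; apply: tcons_ext => [|l x y| |a x]; first exact: linearP.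
- by rewrite !tlmap_linear !scalerDr !scalerA (mulrC l) addrACA.
- by rewrite !tlmap_one scaler0 addr0.
by rewrite !tlmap_cons hE linearPr.
Qed.

Lemma tlmap0 f : tlmap f 0 = 0. Proof. exact: linear0. Qed.

Lemma lcons0 a : lcons a 0 = 0. Proof. exact: linear0. Qed.

Lemma tlmap_comp (f g : {linear T -> T}) x : tlmap f (tlmap g x) = tlmap (f \o g) x.
Proof.
move: x; apply: tcons_ext => [k x y|k x y||a x]; rewrite ?linearP //.
  by rewrite !tlmap_one linear0.
by rewrite !tlmap_cons.
Qed.

Lemma tlmap_posdeg f x : tlmap f x \in posdeg A.
Proof. by apply: tmap_posdeg => z; exact: tdeg1_posdeg. Qed.

Lemma lcons_posdeg a x : lcons a x \in posdeg A.
Proof. exact/tcat_posdeg/tens_posdeg. Qed.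

(* q (x) 1, with q acting on the first two letters; when q vanishes on shorter
   tensors, so does headmap q. *)
Definition headmap (q : {linear T -> T}) : T -> T := tmap 2 q id.

Lemma headmap_linear q : linear (headmap q).
Proof. by apply: tmap_linear => //; exact: linearP. Qed.
HB.instance Definition _ q := GRing.isLinear.Build K T T _ (headmap q) (headmap_linear q).

Lemma headmap_tens q w : headmap q (tens w) = tcat (q (tens (take 2 w))) (tens (drop 2 w)).
Proof.
have idL : linear (@id T) by [].
by rewrite /headmap /tmap tlift_tens //; exact: (tmap_multilinear 2 (linearP q) idL).
Qed.

Lemma headmap_tcat q x y : x \in homog A 2 -> headmap q (tcat x y) = tcat (q x) y.
Proof. by move=> x2; rewrite /headmap tmap_cat //; exact: linearP. Qed.

Lemma headmap_cons q a b x : headmap q (lcons a (lcons b x)) = tcat (q (tens [:: a; b])) x.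
Proof. by rewrite /lcons tcatA tcat_tens headmap_tcat //; exact: (tens_homog [:: a; b]). Qed.
End Words.

(** * The braiding and the product on the first two letters; the braided algebra axioms as operator
    identities *)

Section Operators.
Variables (K : fieldType) (A : lmodType K).
Variables (m : {bilinear A -> A -> A}) (s : {linear tpow A 2 -> tpow A 2}).
Local Notation T := (tensalg A).
Local Notation tone := (tens [::] : T).
Implicit Types (a b c : A) (x y z : T).

HB.instance Definition _ := GRing.isLinear.Build K T T _ (sigma2 s) (sigma2_linear s).
HB.instance Definition _ := GRing.isLinear.Build K T T _ (mul2 m) (mul2_linear m).
HB.instance Definition _ i j := GRing.isLinear.Build K T T _ (beta s i j) (@beta_linear K A s i j).
HB.instance Definition _ i j := GRing.isLinear.Build K T T _ (qsh m s i j) (@qsh_linear K A m s i j).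

Definition sig12 : T -> T := headmap (sigma2 s).
Lemma sig12_linear : linear sig12. Proof. exact: headmap_linear. Qed.
HB.instance Definition _ := GRing.isLinear.Build K T T _ sig12 sig12_linear.
Definition mul12 : T -> T := headmap (mul2 m).
Lemma mul12_linear : linear mul12. Proof. exact: headmap_linear. Qed.
HB.instance Definition _ := GRing.isLinear.Build K T T _ mul12 mul12_linear.
Lemma sig12_0 : sig12 0 = 0. Proof. exact: linear0. Qed.

Lemma mul12_0 : mul12 0 = 0. Proof. exact: linear0. Qed.

Definition op0 := (sig12_0, mul12_0, @tlmap0 K A, @lcons0 K A).
Definition opE := (sig12_linear, mul12_linear, @tlmap_linear K A, @lcons_linear K A).

Lemma sigma2_small w : size w != 2 -> sigma2 s (tens w) = 0.
Proof.
move=> /negbTE sw; rewrite /sigma2 (_ : tproj 2 (tens w) = 0) ?linear0 //.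
by apply: val_inj; rewrite /= tdeg_tens sw.
Qed.

Lemma mul2_tens w : mul2 m (tens w) = if w is [:: a; b] then tens [:: m a b] else 0.
Proof.
rewrite /mul2 tlift_tens // => k a b [|c [|d u]] v /=.
- case: v => [|e [|f v]]; rewrite ?scaler0 ?addr0 // linearPl.
  exact: (tens_multilinear k _ _ [::] [::]).
- case: v => [|e v]; rewrite ?scaler0 ?addr0 // linearPr.
  exact: (tens_multilinear k _ _ [::] [::]).
- by case: u => [|? ?]; rewrite scaler0 addr0.
Qed.

Lemma sig12_small w : (size w < 2)%N -> sig12 (tens w) = 0.
Proof.
by case: w => [|a [|b w]] // _; rewrite /sig12 headmap_tens /= sigma2_small // linear0l.
Qed.

Lemma sig12_cons a b x : sig12 (lcons a (lcons b x)) = tcat (sigma2 s (tens [:: a; b])) x.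
Proof. exact: headmap_cons. Qed.

Lemma mul12_small w : (size w < 2)%N -> mul12 (tens w) = 0.
Proof.
by case: w => [|a [|b w]] // _; rewrite /mul12 headmap_tens /= mul2_tens linear0l.
Qed.

Lemma mul12_cons a b x : mul12 (lcons a (lcons b x)) = lcons (m a b) x.
Proof. by rewrite /mul12 headmap_cons /= mul2_tens. Qed.

Lemma sigma2_homog x : sigma2 s x \in homog A 2.
Proof. exact: valP. Qed.

Lemma tlmap2_tcat (f : {linear T -> T}) x y : x \in homog A 2 ->
  tlmap (tlmap f) (tcat x y) = tcat x (f y).
Proof.
move=> /eqP <-; move: x; apply: tensalg_ext => [k u v|k u v|w].
- by rewrite tdeg_linear linearPl !tlmap_linear.
- by rewrite tdeg_linear linearPl.
rewrite tdeg_tens; case: w => [|a [|b [|c w]]] /=; rewrite ?linear0l ?op0 //.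
by rewrite !tens_cons !tcat_consl !tcat1l tlmap_cons /= tlmap_cons.
Qed.

Lemma tlmap_word1 (f : {linear T -> T}) a : tlmap f (tens [:: a]) = lcons a (f tone).
Proof. by rewrite tens_cons tlmap_cons. Qed.

Lemma tlmap2_sig12 (f : {linear T -> T}) x :
  tlmap (tlmap f) (sig12 x) = sig12 (tlmap (tlmap f) x).
Proof.
move: x; apply: tcons2_ext => [k x y|k x y|[|a [|//]] _|a b x]; rewrite ?opE //.
- by rewrite tlmap_one !sig12_small // !op0.
- by rewrite tlmap_word1 /= tlmap_one linear0 sig12_small // !op0.
by rewrite tlmap_cons /= tlmap_cons !sig12_cons tlmap2_tcat // sigma2_homog.
Qed.

(** The product merges the first two letters, so what acts behind one letter afterwards acts behind
    two letters before. *)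
Lemma tlmap_mul12 (f : {linear T -> T}) x : tlmap f (mul12 x) = mul12 (tlmap (tlmap f) x).
Proof.
move: x; apply: tcons2_ext => [k x y|k x y|[|a [|//]] _|a b x]; rewrite ?opE //.
- by rewrite tlmap_one !mul12_small // !op0.
- by rewrite tlmap_word1 /= tlmap_one linear0 mul12_small // !op0.
by rewrite tlmap_cons /= tlmap_cons !mul12_cons tlmap_cons.
Qed.

Lemma homog_ext n (U : lmodType K) (f g : T -> U) : linear f -> linear g ->
  (forall w, size w = n -> f (tens w) = g (tens w)) -> {in homog A n, f =1 g}.
Proof.
move=> fL gL fg x; rewrite homogE => /eqP <-; move: x.
have f0 := linear_fun0 fL.
have g0 := linear_fun0 gL.
apply: tensalg_ext => [k x y|k x y|w]; rewrite ?(@tdeg_linear K A n) ?fL ?gL //.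
by rewrite tdeg_tens; case: eqP => [/fg //|_]; rewrite f0 g0.
Qed.

Lemma tlmap_homog2 (f : {linear T -> T}) x : (forall c, f (tens [:: c]) = 0) ->
  x \in homog A 2 -> tlmap f x = 0.
Proof.
move=> f0; apply: (homog_ext (g := fun=> 0)) => [k y z|k y z|[|a [|b [|//]]] //= _].
- exact: linearP.
- by rewrite scaler0 addr0.
by rewrite tens_cons tlmap_cons f0 linear0.
Qed.

Lemma tcat3 a b c x : tcat (tens [:: a; b; c]) x = lcons a (lcons b (lcons c x)).
Proof. by rewrite !tens_cons !tcat_consl tcat1l. Qed.

(** The axioms of a braided algebra are stated on A^{(x) 3}, by maps that vanish in other degrees.
    This lemma and the three [tcat_] lemmas after it translate these maps into operators defined on
    all of T(A), with an arbitrary tail [y] attached. *)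
Lemma tcat_sigma1 x y : x \in homog A 3 -> tcat (sigma s 3 1 x) y = sig12 (tcat x y).
Proof.
move: x; apply: homog_ext => [k u v|k u v|[|a [|b [|c [|//]]]] // _].
- by rewrite sigma_linear linearPl.
- by rewrite linearPl linearP.
(* [sigma 3 1] splits off a prefix of length 0, supplied here as the unit tensor. *)
rewrite tcat3 sig12_cons /sigma /= -[tens _]tcat1l.
rewrite tmap_cat ?(tens_homog [::]) //; last first.
- by apply: tmap_linear; exact: linearP.
- exact: linearP.
rewrite tdeg_tens /= tcat1l (tens_cons a) (tens_cons b) /lcons tcatA tcat_tens.
by rewrite tmap_cat ?(tens_homog [:: a; b]) ?tdeg_tens ?tcatA //; exact: linearP.
Qed.

Lemma tcat_sigma2 x y : x \in homog A 3 -> tcat (sigma s 3 2 x) y = tlmap sig12 (tcat x y).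
Proof.
move: x; apply: homog_ext => [k u v|k u v|[|a [|b [|c [|//]]]] // _].
- by rewrite sigma_linear linearPl.
- by rewrite linearPl linearP.
rewrite tcat3 tlmap_cons /= sig12_cons /sigma /= tens_cons.
rewrite tmap_cat ?(tens_homog [:: a]) //; last first.
- by apply: tmap_linear; exact: linearP.
- exact: linearP.
rewrite tdeg_tens /= -[tens [:: b; c]]tcat1r.
rewrite tmap_cat ?(tens_homog [:: b; c]) ?tdeg_tens -?tcatA ?tcat1l //; try exact: linearP.
by rewrite tcat1r.
Qed.

Lemma tcat_mul12 x y : x \in homog A 3 ->
  tcat (tmap 2 (mul2 m) (@tdeg K A 1) x) y = mul12 (tcat x y).
Proof.
have L := tmap_linear 2 (@linearP _ _ _ _ (mul2 m)) (@linearP _ _ _ _ (@tdeg K A 1)).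
move: x; apply: homog_ext => [k u v|k u v|[|a [|b [|c [|//]]]] // _].
- by rewrite L linearPl.
- by rewrite linearPl linearP.
rewrite tcat3 mul12_cons (tens_cons a) (tens_cons b) /lcons tcatA tcat_tens.
rewrite tmap_cat ?(tens_homog [:: a; b]) ?tdeg_tens //; try exact: linearP.
by rewrite mul2_tens -tcatA.
Qed.

Lemma tcat_mul23 x y : x \in homog A 3 ->
  tcat (tmap 1 (@tdeg K A 1) (mul2 m) x) y = tlmap mul12 (tcat x y).
Proof.
have L := tmap_linear 1 (@linearP _ _ _ _ (@tdeg K A 1)) (@linearP _ _ _ _ (mul2 m)).
move: x; apply: homog_ext => [k u v|k u v|[|a [|b [|c [|//]]]] // _].
- by rewrite L linearPl.
- by rewrite linearPl linearP.
rewrite tcat3 tlmap_cons /= mul12_cons (tens_cons a).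
rewrite tmap_cat ?(tens_homog [:: a]) ?tdeg_tens //; try exact: linearP.
by rewrite mul2_tens -tcatA.
Qed.

Lemma homog_stable n p (f : {linear T -> T}) :
  (forall w, size w = n -> f (tens w) \in homog A p) ->
  forall x, x \in homog A n -> f x \in homog A p.
Proof.
move=> fw x xn; rewrite homogE; apply/eqP; move: x xn.
apply: homog_ext => [k x y||w /fw]; [by rewrite linearP tdeg_linear|exact: linearP|].
by rewrite homogE => /eqP.
Qed.

Lemma sigma1_homog x : x \in homog A 3 -> sigma s 3 1 x \in homog A 3.
Proof.
move=> x3; rewrite -[sigma s 3 1 x]tcat1r tcat_sigma1 // tcat1r.
apply: homog_stable x3 => -[|a [|b [|c [|//]]]] // _ /=.
rewrite !tens_cons sig12_cons -tens_cons.
by apply: (@homog_cat _ _ 2 1); [exact: sigma2_homog|exact: (tens_homog [:: c])].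
Qed.

Lemma sigma2_homog3 x : x \in homog A 3 -> sigma s 3 2 x \in homog A 3.
Proof.
move=> x3; rewrite -[sigma s 3 2 x]tcat1r tcat_sigma2 // tcat1r.
apply: homog_stable x3 => -[|a [|b [|c [|//]]]] // _ /=.
rewrite !tens_cons tlmap_cons /= sig12_cons tcat1r.
by apply: (@homog_cat _ _ 1 2); [exact: (tens_homog [:: a])|exact: sigma2_homog].
Qed.

Lemma tcons3_ext (U : lmodType K) (f g : T -> U) : linear f -> linear g ->
    (forall w, (size w < 3)%N -> f (tens w) = g (tens w)) ->
    (forall x y, x \in homog A 3 -> f (tcat x y) = g (tcat x y)) ->
  f =1 g.
Proof.
move=> fL gL fg1 fg; apply: tensalg_ext => // -[|a [|b [|c w]]]; try exact: fg1.
by have := fg _ (tens w) (tens_homog [:: a; b; c]); rewrite tcat_tens.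
Qed.

Lemma sig12_word1 c : sig12 (tens [:: c]) = 0. Proof. exact: sig12_small. Qed.

Lemma mul12_word1 c : mul12 (tens [:: c]) = 0. Proof. exact: mul12_small. Qed.

Lemma sig12_homog n x : x \in homog A n -> sig12 x \in homog A n.
Proof.
apply: homog_stable => -[|a [|b w]] /= <-; try by rewrite sig12_small ?rpred0.
rewrite !tens_cons sig12_cons.
by apply: (@homog_cat _ _ 2 (size w)); [exact: sigma2_homog|exact: tens_homog].
Qed.

Lemma mul12_homog2 x : x \in homog A 2 -> mul12 x \in homog A 1.
Proof.
apply: homog_stable => -[|a [|b [|//]]] // _ /=.
by rewrite !tens_cons mul12_cons -tens_cons (tens_homog [:: _]).
Qed.

Lemma mul12_homog3 x : x \in homog A 3 -> mul12 x \in homog A 2.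
Proof.
apply: homog_stable => -[|a [|b [|c [|//]]]] // _ /=.
by rewrite !tens_cons mul12_cons -!tens_cons (tens_homog [:: _; _]).
Qed.

Lemma tlmap_mul12_homog3 x : x \in homog A 3 -> tlmap mul12 x \in homog A 2.
Proof.
apply: homog_stable => -[|a [|b [|c [|//]]]] // _ /=.
by rewrite !tens_cons tlmap_cons /= mul12_cons -!tens_cons (tens_homog [:: _; _]).
Qed.

Lemma sig12_homog1 x : x \in homog A 1 -> sig12 x = 0.
Proof.
apply: (homog_ext (g := fun=> 0)) => [k y z|k y z|w w1];
  rewrite ?linearP ?scaler0 ?addr0 //.
by rewrite sig12_small // w1.
Qed.

Lemma small_cases (P : seq A -> Prop) : P [::] -> (forall a, P [:: a]) ->
  (forall w, tens w \in homog A 2 -> P w) -> forall w, (size w < 3)%N -> P w.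
Proof.
move=> P0 P1 P2 [|a [|b [|//]]] // _; apply: P2; exact: (tens_homog [:: a; b]).
Qed.

Hypothesis brA : braided_algebra m s.

(** With a tail split off behind three letters this is the braid relation in A^{(x) 3}. On shorter
    words both sides are 0, because some factor meets too few letters. The two compatibilities of
    the braiding with [m] below are lifted in the same way. *)
Lemma braid x : sig12 (tlmap sig12 (sig12 x)) = tlmap sig12 (sig12 (tlmap sig12 x)).
Proof.
move: x; apply: tcons3_ext => [k x y|k x y||x y x3]; rewrite ?opE //.
  apply: small_cases => [|a|w w2].
  - by rewrite tlmap_one sig12_small // !op0.
  - by rewrite tlmap_word1 /= !sig12_small // !op0.
  by rewrite (tlmap_homog2 sig12_word1 w2) (tlmap_homog2 sig12_word1 (sig12_homog w2)) !op0.
case: brA => _ [_ /(_ (Tpow x3)) /= br] _ _.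
by rewrite -!(tcat_sigma1, tcat_sigma2) ?sigma1_homog ?sigma2_homog3 ?sigma1_homog // br.
Qed.

Lemma sig12_mul12 x : tlmap mul12 (sig12 (tlmap sig12 x)) = sig12 (mul12 x).
Proof.
move: x; apply: tcons3_ext => [k x y|k x y||x y x3]; rewrite ?opE //.
  apply: small_cases => [|a|w w2].
  - by rewrite tlmap_one mul12_small // !op0.
  - by rewrite tlmap_word1 /= mul12_small ?sig12_small // !op0.
  by rewrite (tlmap_homog2 sig12_word1 w2) (sig12_homog1 (mul12_homog2 w2)) !op0.
case: brA => _ _ /(_ (Tpow x3)) /= br _.
rewrite -!(tcat_sigma1, tcat_sigma2) ?sigma2_homog3 //.
rewrite -tcat_mul23 ?sigma1_homog ?sigma2_homog3 // br -tcat_mul12 //.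
have Mx : tmap 2 (mul2 m) (@tdeg K A 1) x \in homog A 2.
  by have := tcat_mul12 tone x3; rewrite !tcat1r => ->; exact: mul12_homog3.
by rewrite /sig12 (headmap_tcat _ _ Mx).
Qed.

Lemma sig12_tlmap_mul12 x : mul12 (tlmap sig12 (sig12 x)) = sig12 (tlmap mul12 x).
Proof.
move: x; apply: tcons3_ext => [k x y|k x y||x y x3]; rewrite ?opE //.
  apply: small_cases => [|a|w w2].
  - by rewrite tlmap_one sig12_small // !op0.
  - by rewrite tlmap_word1 /= mul12_small ?sig12_small // !op0.
  by rewrite (tlmap_homog2 sig12_word1 (sig12_homog w2)) (tlmap_homog2 mul12_word1 w2) !op0.
case: brA => _ _ _ /(_ (Tpow x3)) /= br.
rewrite -!(tcat_sigma1, tcat_sigma2) ?sigma1_homog //.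
rewrite -tcat_mul12 ?sigma1_homog ?sigma2_homog3 ?sigma1_homog // br -tcat_mul23 //.
have Mx : tmap 1 (@tdeg K A 1) (mul2 m) x \in homog A 2.
  by have := tcat_mul23 tone x3; rewrite !tcat1r => ->; exact: tlmap_mul12_homog3.
by rewrite /sig12 (headmap_tcat _ _ Mx).
Qed.

Lemma mul12_tlmap_mul12 x : mul12 (tlmap mul12 x) = mul12 (mul12 x).
Proof.
move: x; apply: tcons2_ext => [k x y|k x y|[|a [|//]] _|a b]; rewrite ?opE //.
- by rewrite tlmap_one mul12_small // !op0.
- by rewrite tlmap_word1 /= !mul12_small // !op0.
case: brA => mA _ _ _.
apply: tcons_ext => [k x y|k x y||c x]; rewrite ?opE //.
  by rewrite tlmap_cons /= mul12_cons -!tens_cons !mul12_small // !op0.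
by rewrite tlmap_cons /= !mul12_cons mA.
Qed.
End Operators.

(** * Bilinearity of operations given by blocks *)

Section Blockop.
Variables (K : fieldType) (A : lmodType K) (G : nat -> nat -> tensalg A -> tensalg A).
Hypothesis GL : forall p q, linear (G p q).

Lemma block_multilinearr u :
  multilinear (fun v => G (size u) (size v) (tens (u ++ v))).
Proof. by move=> k a b v w; rewrite !size_cat !catA tens_multilinear GL. Qed.

Lemma block_multilinearl v :
  multilinear (fun u => G (size u) (size v) (tens (u ++ v))).
Proof. by move=> k a b u w; rewrite !size_cat -!catA tens_multilinear GL. Qed.

Lemma blockop_bilinear : bilinear_for *:%R *:%R (blockop G).
Proof.
by apply: tlift2_bilinear; [exact: block_multilinearr|exact: block_multilinearl].
Qed.

Lemma blockop_tens u v :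
  blockop G (tens u) (tens v) = G (size u) (size v) (tens (u ++ v)).
Proof.
by apply: tlift2_tens; [exact: block_multilinearr|exact: block_multilinearl].
Qed.
End Blockop.

(** * Braiding one letter to the front *)

Section Front.
Variables (K : fieldType) (A : lmodType K).
Variables (m : {bilinear A -> A -> A}) (s : {linear tpow A 2 -> tpow A 2}).
Local Notation T := (tensalg A).
Local Notation tone := (tens [::] : T).
Local Notation sig12 := (sig12 s).
Local Notation mul12 := (mul12 m).
Implicit Types (a b c : A) (x y z t : T).

(** This is sigma_1 ... sigma_n applied to [rcons w c], n being the length of [w], in the order of
    the reduced expression of [chi n 1]: [c] crosses the letters of [w] from the last to the
    first. *)
Definition front_word c w : T := foldr (fun a x => sig12 (lcons a x)) (tens [:: c]) w.

Lemma front_word_multilinear c : multilinear (front_word c).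
Proof.
move=> k a b u v; rewrite /front_word !foldr_cat /= linearPl sig12_linear.
elim: u => [//|d u ih] /=.
by rewrite ih lcons_linear sig12_linear.
Qed.

(* front c x is beta_{i,1} (x (x) c) for x of degree i. *)
Definition front c : T -> T := tlift (front_word c).

Lemma front_linear c : linear (front c).
Proof. exact/tlift_linear/front_word_multilinear. Qed.
HB.instance Definition _ c := GRing.isLinear.Build K T T _ (front c) (front_linear c).

Lemma front_tens c w : front c (tens w) = front_word c w.
Proof. exact/tlift_tens/front_word_multilinear. Qed.

Lemma front_one c : front c tone = tens [:: c].
Proof. by rewrite front_tens. Qed.

Lemma front_cons c a x : front c (lcons a x) = sig12 (lcons a (front c x)).
Proof.
move: x; apply: tensalg_ext => [k x y|k x y|w].
- by rewrite lcons_linear front_linear.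
- by rewrite front_linear lcons_linear sig12_linear.
by rewrite -tens_cons !front_tens.
Qed.

Lemma front_linearl x k b c : front (k *: b + c) x = k *: front b x + front c x.
Proof.
move: x; apply: tensalg_ext => [l x y|l x y|].
- by rewrite front_linear.
- by rewrite !front_linear !scalerDr !scalerA (mulrC k) addrACA.
elim=> [|a w ih].
  by rewrite !front_one (tens_multilinear k b c [::] [::]).
by rewrite tens_cons !front_cons ih lcons_linear sig12_linear.
Qed.

Lemma homog_posdeg n x : x \in homog A n.+1 -> x \in posdeg A.
Proof.
move=> xn; rewrite posdegE; apply/eqP; move: x xn.
apply: homog_ext => [k x y|k x y|w wn]; rewrite ?tdeg_linear ?scaler0 ?addr0 //.
by rewrite tdeg_tens wn.
Qed.

Lemma sig12_posdeg x : sig12 x \in posdeg A.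
Proof. by apply: tmap_posdeg => z; exact/homog_posdeg/sigma2_homog. Qed.

Lemma mul12_posdeg x : mul12 x \in posdeg A.
Proof. by apply: tmap_posdeg => z; exact: mul2_posdeg. Qed.

Lemma front_posdeg c x : front c x \in posdeg A.
Proof.
rewrite posdegE; apply/eqP; move: x; apply: tcons_ext => [k x y|k x y||a x].
- by rewrite front_linear tdeg_linear.
- by rewrite scaler0 addr0.
- by rewrite front_one tdeg_tens.
by rewrite front_cons; apply/eqP; rewrite -posdegE sig12_posdeg.
Qed.

(** The recursion [front_cons] in a form that names no first letter, so that it applies to any
    tensor known to lie in T^+. *)
Lemma front_pos c : {in posdeg A, forall x, front c x = sig12 (tlmap (front c) x)}.
Proof.
apply: posdeg_ext => [k x y|k x y|a x]; rewrite ?front_linear ?opE //.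
by rewrite front_cons tlmap_cons.
Qed.

Lemma lcons_homog a n x : x \in homog A n -> lcons a x \in homog A n.+1.
Proof. exact: (homog_cat (tens_homog [:: a])). Qed.

Lemma front_homog c n x : x \in homog A n -> front c x \in homog A n.+1.
Proof.
apply: homog_stable => w <-; elim: w => [|a w ih] /=.
  by rewrite front_one; exact: (tens_homog [:: c]).
by rewrite tens_cons front_cons; apply/sig12_homog/lcons_homog.
Qed.

Lemma tmap_sigma2_tdeg p x : x \in homog A (2 + p) ->
  tmap 2 (sigma2 s) (@tdeg K A p) x = sig12 x.
Proof.
have L := tmap_linear 2 (@sigma2_linear K A s) (@tdeg_linear K A p).
move: x; apply: homog_ext => // [k x y|[|a [|b w]] //= [wp]].
  by rewrite sig12_linear.
rewrite !tens_cons sig12_cons /lcons tcatA tcat_tens tmap_cat; last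
  exact: (tens_homog [:: a; b]).
- by rewrite tdeg_tens wp eqxx.
- exact: sigma2_linear.
exact: tdeg_linear.
Qed.

(** The untouched prefix [u] is there for the induction: removing the first index of the run does
    not shorten the word but shifts where the run begins, and the letter skipped is absorbed into
    [u]. *)
Lemma sigma_foldr N b u v : N = (size u + size v).+1 ->
  foldr (fun i f => sigma s N i.+1 \o f) (@tdeg K A N)
    (iota (size u) (size v)) (tens (u ++ rcons v b)) = tcat (tens u) (front b (tens v)).
Proof.
elim: v u => [|a v ih] u /= NE.
  by rewrite front_one tcat_tens tdeg_tens size_cat NE addn0 addn1 eqxx.
(* Moving [a] into the prefix makes the remaining indices start at its end, as the induction
   hypothesis requires. *)
have -> : u ++ a :: rcons v b = rcons u a ++ rcons v b by rewrite cat_rcons.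
have -> : (size u).+1 = size (rcons u a) by rewrite size_rcons.
rewrite ih; last by rewrite size_rcons NE addSnnS.
rewrite size_rcons -cats1 -tcat_tens -tcatA /sigma [_.+1.-1]/=.
rewrite tmap_cat; [|exact: tdeg_linear| |exact: tens_homog]; last first.
  by apply: tmap_linear; [exact: sigma2_linear|exact: tdeg_linear].
rewrite tdeg_tens eqxx (tens_cons a v) front_cons; congr (tcat _ _).
have -> : (N - (size u).+1 - 1 = size v)%N by rewrite NE subSS addKn subn1.
by rewrite -/(lcons a _) tmap_sigma2_tdeg //; apply/lcons_homog/front_homog/tens_homog.
Qed.

Lemma beta1_tens b u : beta s (size u) 1 (tens (rcons u b)) = front b (tens u).
Proof.
case: u => [|a u]; first by rewrite front_one /beta /= tdeg_tens.
by rewrite beta1E // (@sigma_foldr _ b [::] (a :: u)) ?tcat1l // add0n addn1.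
Qed.
End Front.

(** * Right multiplication operators, and the three operations expressed through them *)

Section Twist.
Variables (K : fieldType) (A : lmodType K).
Variables (m : {bilinear A -> A -> A}) (s : {linear tpow A 2 -> tpow A 2}).
Local Notation T := (tensalg A).
Local Notation tone := (tens [::] : T).
Local Notation sig12 := (sig12 s).
Local Notation mul12 := (mul12 m).
Local Notation front := (front s).
Implicit Types (a b c : A) (x y z t : T).

(* The second factor comes first: shuf y and succs y are right multiplications. *)
Definition shuf y x : T := qshuffle m s x y.

Lemma shuf_linear y : linear (shuf y).
Proof. by move=> k x z; exact: (blockop_bilinear (@qsh_linear K A m s)).1. Qed.
HB.instance Definition _ y := GRing.isLinear.Build K T T _ (shuf y) (shuf_linear y).

Lemma shuf_linearl x k y z : shuf (k *: y + z) x = k *: shuf y x + shuf z x.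
Proof. exact: (blockop_bilinear (@qsh_linear K A m s)).2. Qed.

Lemma shuf_tens u v : shuf (tens v) (tens u) = qsh m s (size u) (size v) (tens (u ++ v)).
Proof. exact/blockop_tens/qsh_linear. Qed.

Lemma shuf_homog p q x y : x \in homog A p -> y \in homog A q ->
  shuf y x = qsh m s p q (tcat x y).
Proof. exact/blockop_homog/qsh_linear. Qed.

Lemma shuf1l x : shuf tone x = x.
Proof.
move: x; apply: tensalg_ext => [k x y|//|w]; first by rewrite shuf_linear.
by rewrite shuf_tens cats0; case: w => [|a w]; rewrite /= tdeg_tens //= eqxx.
Qed.

Lemma shuf1r y : shuf y tone = y.
Proof.
move: y; apply: tensalg_ext => [k x y|//|w]; first by rewrite shuf_linearl.
by rewrite shuf_tens /= tdeg_tens eqxx.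
Qed.

Section Functor.
Variable F : T -> {linear T -> T}.
Hypothesis F_linearl : forall x k y z, F (k *: y + z) x = k *: F y x + F z x.

(* twist F (b (x) y) = (1 (x) F y) beta_b *)
Definition twist t x := uncons (fun b y => tlmap (F y) (front b x)) t.

Lemma twist_bilinear x : bilinear_for *:%R *:%R (fun b y => tlmap (F y) (front b x)).
Proof.
split=> [y k b c|b k y z].
  by rewrite front_linearl tlmap_linear.
by apply: (tlmap_lin (f := F y)) => u; rewrite F_linearl.
Qed.

Lemma twist_linearl x k y z : twist (k *: y + z) x = k *: twist y x + twist z x.
Proof. exact/uncons_linear/twist_bilinear. Qed.

Lemma twist_one x : twist tone x = 0.
Proof. exact/uncons1/twist_bilinear. Qed.

Lemma twist_cons b y x : twist (lcons b y) x = tlmap (F y) (front b x).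
Proof. exact: (uncons_cons (twist_bilinear x)). Qed.

Lemma twist_linear t : linear (twist t).
Proof.
move=> k x y; move: t; apply: tcons_ext => [l u v|l u v||b t].
- exact: twist_linearl.
- by rewrite !twist_linearl !scalerDr !scalerA (mulrC k) addrACA.
- by rewrite !twist_one scaler0 addr0.
by rewrite !twist_cons front_linear tlmap_linear.
Qed.
End Functor.

(* x > t for x in T^+, extended by 1 > t = t on scalars. *)
Definition succs := twist (fun y => shuf y).
Definition succs_linear : forall t, linear (succs t) := twist_linear shuf_linearl.
HB.instance Definition _ t := GRing.isLinear.Build K T T _ (succs t) (succs_linear t).
Definition succs_linearl : forall x k y z, succs (k *: y + z) x = k *: succs y x + succs z x :=
  twist_linearl shuf_linearl.

(** Two leading letters b, c of the first argument are braided to the front and the rest is shuffled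
    in behind them; see [succ2_cons2]. Operators on the first two letters of [t] leave [succs] and
    [succ2] in this form: see [succs_mul12] and [succ2_sig12]. *)
Definition succ2 := twist (fun y => succs y).
Definition succ2_linear : forall t, linear (succ2 t) := twist_linear succs_linearl.
HB.instance Definition _ t := GRing.isLinear.Build K T T _ (succ2 t) (succ2_linear t).
Definition succ2_linearl : forall x k y z, succ2 (k *: y + z) x = k *: succ2 y x + succ2 z x :=
  twist_linearl succs_linearl.

Lemma succs_one x : succs tone x = 0. Proof. exact: (twist_one shuf_linearl). Qed.

Lemma succs_cons b y x : succs (lcons b y) x = tlmap (shuf y) (front b x).
Proof. exact: (twist_cons shuf_linearl). Qed.

Lemma succ2_one x : succ2 tone x = 0. Proof. exact: (twist_one succs_linearl). Qed.

Lemma succ2_cons b y x : succ2 (lcons b y) x = tlmap (succs y) (front b x).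
Proof. exact: (twist_cons succs_linearl). Qed.

Definition opL := (sig12_linear, mul12_linear, @tlmap_linear K A, @lcons_linear K A,
  @front_linear K A, shuf_linear, succs_linear, succ2_linear).

Lemma tlmap_qsh p q x y : x \in homog A p.+1 -> y \in homog A q ->
  tmap 1 (@tdeg K A 1) (qsh m s p q) (tcat x y) = tlmap (shuf y) x.
Proof.
move=> xp yq; have L := tmap_linear 1 (@tdeg_linear K A 1) (@qsh_linear K A m s p q).
move: x xp; apply: homog_ext => [k x z|k x z|[|a w] // [wp]].
- by rewrite linearPl L.
- by rewrite tlmap_linear.
rewrite tens_cons tlmap_cons /= tcat_consl tmap_cat.
- by rewrite tdeg_tens -wp (shuf_homog (tens_homog w) yq).
- exact: tdeg_linear.
- exact: qsh_linear.
exact: (tens_homog [:: a]).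
Qed.

Lemma mul_qsh a p q x y : x \in homog A p.+1 -> y \in homog A q ->
  tmap 2 (mul2 m) (qsh m s p q) (lcons a (tcat x y)) = mul12 (lcons a (tlmap (shuf y) x)).
Proof.
move=> xp yq; have L := tmap_linear 2 (@mul2_linear K A m) (@qsh_linear K A m s p q).
move: x xp; apply: homog_ext => [k x z|k x z|[|b w] // [wp]].
- by rewrite linearPl lcons_linear L.
- by rewrite tlmap_linear lcons_linear mul12_linear.
rewrite tens_cons tlmap_cons /= mul12_cons tcat_consl /lcons tcatA tcat_tens tmap_cat.
- by rewrite mul2_tens -wp (shuf_homog (tens_homog w) yq).
- exact: mul2_linear.
- exact: qsh_linear.
exact: (tens_homog [:: a; b]).
Qed.

Lemma shift_word u b v :
  tmap (size u).+1 (beta s (size u) 1) (@tdeg K A (size v)) (tens (u ++ b :: v)) =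
  tcat (front b (tens u)) (tens v).
Proof.
rewrite -cat_rcons -tcat_tens tmap_cat.
- by rewrite beta1_tens tdeg_tens eqxx.
- exact: beta_linear.
- exact: tdeg_linear.
by rewrite -(size_rcons u b); exact: tens_homog.
Qed.

(** Together with [succ_word] and [dot_word] this puts the three summands in the recursion for [qsh]
    into operator form. The same lemmas identify the three operations of the theorem, whose blocks
    are these summands. *)
Lemma prec_word a u v :
  tmap 1 (@tdeg K A 1) (qsh m s (size u) (size v)) (tens (a :: u ++ v)) =
  lcons a (shuf (tens v) (tens u)).
Proof.
rewrite tens_cons tmap_cat.
- by rewrite tdeg_tens shuf_tens.
- exact: tdeg_linear.
- exact: qsh_linear.
exact: (tens_homog [:: a]).
Qed.

Lemma succ_word u b v :
  tmap 1 (@tdeg K A 1) (qsh m s (size u) (size v))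
    (tmap (size u).+1 (beta s (size u) 1) (@tdeg K A (size v)) (tens (u ++ b :: v))) =
  succs (tens (b :: v)) (tens u).
Proof.
rewrite shift_word tlmap_qsh; [|exact/front_homog/tens_homog|exact: tens_homog].
by rewrite tens_cons succs_cons.
Qed.

Lemma dot_word a u b v :
  tmap 2 (mul2 m) (qsh m s (size u) (size v))
    (tmap 1 (@tdeg K A 1) (tmap (size u).+1 (beta s (size u) 1) (@tdeg K A (size v)))
      (tens (a :: u ++ b :: v))) =
  mul12 (tlmap (succs (tens (b :: v))) (tens (a :: u))).
Proof.
rewrite [tens (a :: u ++ _)]tens_cons tmap_cat; last exact: (tens_homog [:: a]).
- rewrite shift_word tdeg_tens /= -/(lcons a _) mul_qsh.
  + by rewrite !tens_cons tlmap_cons /= succs_cons.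
  + exact/front_homog/tens_homog.
  exact: tens_homog.
- exact: tdeg_linear.
exact: tmap_beta_linear.
Qed.

Lemma shuf_word a u b v : shuf (tens (b :: v)) (tens (a :: u)) =
  tlmap (shuf (tens (b :: v))) (tens (a :: u)) + succs (tens (b :: v)) (tens (a :: u))
  + mul12 (tlmap (succs (tens (b :: v))) (tens (a :: u))).
Proof.
rewrite shuf_tens [size _]/= [size (b :: _)]/= qshSS.
rewrite (@prec_word a u (b :: v)) (succ_word (a :: u)) dot_word.
by congr (_ + _ + _); rewrite (tens_cons a u) tlmap_cons.
Qed.

Lemma tlmap_shuf_linearl x : linear (fun y => tlmap (shuf y) x).
Proof. by move=> k y z; apply: (tlmap_lin (f := shuf y)) => u; exact: shuf_linearl. Qed.

Lemma tlmap_succs_linearl x : linear (fun y => tlmap (succs y) x).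
Proof. by move=> k y z; apply: (tlmap_lin (f := succs y)) => u; exact: succs_linearl. Qed.

Definition shuf_parts y x : T := tlmap (shuf y) x + succs y x + mul12 (tlmap (succs y) x).

Lemma shuf_parts_linear y : linear (shuf_parts y).
Proof.
apply: linear_add; last by move=> k u v; rewrite !opL.
by apply: linear_add; exact: linearP.
Qed.

Lemma shuf_parts_linearl x : linear (shuf_parts^~ x).
Proof.
apply: linear_add; last by move=> k u v; rewrite tlmap_succs_linearl mul12_linear.
by apply: linear_add => [|k u v]; [exact: tlmap_shuf_linearl|exact: succs_linearl].
Qed.

(** T^+ is spanned by nonempty words, so the blocks of degree 0, where [qsh] differs from the three
    operations, do not enter. *)
Lemma blockop_pos_ext G (H : T -> T -> T) x y : (forall p q, linear (G p q)) ->
    (forall y, linear (H y)) -> (forall x, linear (H^~ x)) ->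
    (forall a u b v, G (size u).+1 (size v).+1 (tens ((a :: u) ++ b :: v)) =
       H (tens (b :: v)) (tens (a :: u))) ->
  x \in posdeg A -> y \in posdeg A -> blockop G x y = H y x.
Proof.
move=> GL HL HLl GH x0 y0; have [Bl Br] := blockop_bilinear GL.
move: y y0; apply: posdeg_ext => [k y z|//|b y]; first exact: Br.
move: x x0; apply: posdeg_ext => [k u v|//|a x]; first exact: Bl.
move: y; apply: tensalg_ext => [k y z|k y z|v].
- by rewrite lcons_linear Br.
- by rewrite lcons_linear HLl.
move: x; apply: tensalg_ext => [k y z|k y z|u].
- by rewrite lcons_linear Bl.
- by rewrite lcons_linear HL.
by rewrite -!tens_cons blockop_tens // GH.
Qed.

Lemma shuf_posE y x : y \in posdeg A -> x \in posdeg A -> shuf y x = shuf_parts y x.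
Proof.
move=> y0 x0; apply: (blockop_pos_ext (@qsh_linear K A m s)) => //.
- exact: shuf_parts_linear.
- exact: shuf_parts_linearl.
by move=> a u b v; rewrite /shuf_parts -shuf_word shuf_tens.
Qed.

Lemma val_qprec (x y : tplus A) : qprec m s x y = tlmap (shuf y) x :> T.
Proof.
apply: (blockop_pos_ext (H := fun y x => tlmap (shuf y) x)); try exact: valP.
- exact: prec_block_linear.
- by move=> z; exact: tlmap_linear.
- exact: tlmap_shuf_linearl.
move=> a u b v; rewrite /prec_block (@prec_word a u (b :: v)).
by rewrite [tens (a :: u)]tens_cons tlmap_cons.
Qed.

Lemma val_qsucc (x y : tplus A) : qsucc m s x y = succs y x :> T.
Proof.
apply: (blockop_pos_ext (H := succs)); try exact: valP.
- exact: succ_block_linear.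
- exact: succs_linear.
- by move=> z k u v; exact: succs_linearl.
by move=> a u b v; exact: (succ_word (a :: u)).
Qed.

Lemma val_qdot (x y : tplus A) : qdot m s x y = mul12 (tlmap (succs y) x) :> T.
Proof.
apply: (blockop_pos_ext (H := fun y x => mul12 (tlmap (succs y) x))); try exact: valP.
- exact: dot_block_linear.
- by move=> z k u v; rewrite !opL.
- by move=> z k u v; rewrite tlmap_succs_linearl mul12_linear.
by move=> a u b v; exact: dot_word.
Qed.
End Twist.

(** * How moving a letter to the front commutes with product, braiding and quasi-shuffle *)

Section Associativity.
Variables (K : fieldType) (A : lmodType K).
Variables (m : {bilinear A -> A -> A}) (s : {linear tpow A 2 -> tpow A 2}).
Hypothesis brA : braided_algebra m s.
Local Notation T := (tensalg A).
Local Notation tone := (tens [::] : T).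
Local Notation sig12 := (sig12 s).
Local Notation mul12 := (mul12 m).
Local Notation front := (front s).
Local Notation shuf := (shuf m s).
Local Notation succs := (succs m s).
Local Notation succ2 := (succ2 m s).
Local Notation opL := (opL m s).
Local Notation op0 := (op0 m s).
Implicit Types (a b c : A) (x y z t : T).

Lemma tlmap_compE (f g h : {linear T -> T}) : (forall x, f (g x) = h x) ->
  forall x, tlmap f (tlmap g x) = tlmap h x.
Proof. by move=> fgh x; rewrite tlmap_comp; apply: eq_tlmap. Qed.

(** The image of [sig12] is spanned by words of at least two letters, so f and g may differ on
    shorter tensors. *)
Lemma sig12_ext (U : lmodType K) (f g : T -> U) : linear f -> linear g ->
  (forall a b x, f (lcons a (lcons b x)) = g (lcons a (lcons b x))) ->
  forall x, f (sig12 x) = g (sig12 x).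
Proof.
move=> fL gL fg.
have f0 := linear_fun0 fL.
have g0 := linear_fun0 gL.
apply: tcons2_ext => [k x y|k x y|w w1|a b x]; rewrite ?sig12_linear ?fL ?gL //.
  by rewrite sig12_small // f0 g0.
rewrite sig12_cons; move: (sigma2 _ _) (sigma2_homog s (tens [:: a; b])).
apply: homog_ext => [k u v|k u v|[|c [|d [|//]]] // _].
- by rewrite linearPl fL.
- by rewrite linearPl gL.
by rewrite !tens_cons !tcat_consl tcat1l fg.
Qed.

(** The letter c first crosses everything behind the first two letters, which commutes with [sig12],
    and then the second letter. *)
Lemma tlmap_front_sig12 c x :
  tlmap (front c) (sig12 x) = tlmap sig12 (sig12 (tlmap (tlmap (front c)) x)).
Proof.
rewrite -tlmap2_sig12; apply: (sig12_ext (f := tlmap (front c))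
  (g := tlmap sig12 \o tlmap (tlmap (front c))))
  => [k y z|k y z|a b y]; rewrite /= ?opL //.
by rewrite !tlmap_cons /= tlmap_cons /= front_cons.
Qed.

(** By induction on the word crossed: each further letter a is passed by (m (x) 1) sigma_2 sigma_1 =
    sigma (1 (x) m). *)
Lemma front_mul b c x : front (m b c) x = mul12 (tlmap (front c) (front b x)).
Proof.
move: x; apply: tensalg_ext => [k x y|k x y|]; rewrite ?opL //.
elim=> [|a w ih].
  by rewrite !front_one tlmap_word1 /= front_one !tens_cons mul12_cons.
rewrite tens_cons !front_cons ih tlmap_front_sig12 tlmap_cons /= (sig12_tlmap_mul12 brA).
by rewrite tlmap_cons.
Qed.

Lemma tlmap_succs_one x : tlmap (succs tone) x = 0.
Proof.
move: x; apply: tcons_ext => [k x y|k x y||a x]; rewrite ?opL //.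
- by rewrite scaler0 addr0.
- exact: tlmap_one.
by rewrite tlmap_cons /= succs_one lcons0.
Qed.

Lemma succs0 x : succs 0 x = 0.
Proof. by apply: (linear_fun0 (f := succs^~ x)) => k u v; exact: succs_linearl. Qed.

Lemma succ2_0 x : succ2 0 x = 0.
Proof. by apply: (linear_fun0 (f := succ2^~ x)) => k u v; exact: succ2_linearl. Qed.

Lemma succs_mul12 t x : succs (mul12 t) x = mul12 (succ2 t x).
Proof.
move: t; apply: tcons2_ext => [k y z|k y z|[|b [|//]] _|b c y].
- by rewrite mul12_linear succs_linearl.
- by rewrite succ2_linearl mul12_linear.
- by rewrite mul12_small // succ2_one mul12_0 succs0.
- by rewrite mul12_small // tens_cons succ2_cons tlmap_succs_one mul12_0 succs0.
rewrite mul12_cons succs_cons succ2_cons front_mul tlmap_mul12; congr (mul12 _).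
by rewrite (tlmap_compE (h := succs (lcons c y))) // => z; rewrite /= succs_cons.
Qed.

Lemma succ2_cons2 b c y x :
  succ2 (lcons b (lcons c y)) x = tlmap (tlmap (shuf y)) (tlmap (front c) (front b x)).
Proof.
by rewrite succ2_cons (tlmap_compE (h := succs (lcons c y))) // => z; rewrite /= succs_cons.
Qed.

Lemma tlmap_shuf_one x : x \in posdeg A -> tlmap (shuf tone) x = x.
Proof.
move: x; apply: (posdeg_ext (g := id)) => [|//|a x]; first exact: tlmap_linear.
by rewrite tlmap_cons /= shuf1l.
Qed.

Lemma succ2_word2 b c x : succ2 (tens [:: b; c]) x = tlmap (front c) (front b x).
Proof. rewrite !tens_cons succ2_cons2 (tlmap_compE (h := front c)) // => z.
exact/tlmap_shuf_one/front_posdeg. Qed.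

Lemma succ2_tcat q y x : q \in homog A 2 -> succ2 (tcat q y) x = tlmap (tlmap (shuf y)) (succ2 q x).
Proof.
move: q; apply: homog_ext => [k u v|k u v|[|b [|c [|//]]] // _].
- by rewrite linearPl succ2_linearl.
- by rewrite succ2_linearl !tlmap_linear.
by rewrite succ2_word2 -succ2_cons2 !tens_cons !tcat_consl tcat1l.
Qed.

Lemma succ2_tone q : q \in homog A 2 -> succ2 q tone = q.
Proof.
move: q; apply: homog_ext => [k u v|//|[|b [|c [|//]]] // _].
  by rewrite succ2_linearl.
by rewrite succ2_word2 front_one tlmap_word1 /= front_one -tens_cons.
Qed.

Lemma succ2_consr q a x : q \in homog A 2 ->
  succ2 q (lcons a x) = tlmap sig12 (sig12 (lcons a (succ2 q x))).
Proof.
move: q; apply: homog_ext => [k u v|k u v|[|b [|c [|//]]] // _].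
- by rewrite succ2_linearl.
- by rewrite succ2_linearl !opL.
by rewrite !succ2_word2 front_cons tlmap_front_sig12 tlmap_cons.
Qed.

(** By [succ2_consr], both letters of [q] cross a letter of [x] through sigma_2 sigma_1; the braid
    relation lets the braiding of these two letters pass through each such crossing. *)
Lemma succ2_sig12_homog q x : q \in homog A 2 -> succ2 (sig12 q) x = sig12 (succ2 q x).
Proof.
move=> q2; have Sq2 := sig12_homog s q2; move: x.
apply: tensalg_ext => [k x y|k x y|]; rewrite ?opL //.
elim=> [|a w ih]; first by rewrite !succ2_tone.
rewrite tens_cons !succ2_consr // ih (braid brA); congr (tlmap _ (sig12 _)).
by rewrite tlmap_cons.
Qed.

Lemma succ2_sig12 t x : succ2 (sig12 t) x = sig12 (succ2 t x).
Proof.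
move: t; apply: tcons2_ext => [k y z|k y z|[|b [|//]] _|b c y].
- by rewrite sig12_linear succ2_linearl.
- by rewrite succ2_linearl sig12_linear.
- by rewrite sig12_small // succ2_one sig12_0 succ2_0.
- by rewrite sig12_small // tens_cons succ2_cons tlmap_succs_one sig12_0 succ2_0.
have bc2 := tens_homog [:: b; c].
have E : lcons b (lcons c y) = tcat (tens [:: b; c]) y.
  by rewrite !tens_cons !tcat_consl tcat1l.
have S2 : sigma2 s (tens [:: b; c]) = sig12 (tens [:: b; c]).
  by rewrite !tens_cons sig12_cons tcat1r -!tens_cons.
rewrite sig12_cons succ2_tcat ?S2; last exact: sig12_homog.
by rewrite succ2_sig12_homog // E succ2_tcat // tlmap2_sig12.
Qed.

Lemma succs_tone t : t \in posdeg A -> succs t tone = t.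
Proof.
move: t; apply: posdeg_ext => [k y z|//|b y]; first exact: succs_linearl.
by rewrite succs_cons front_one tlmap_word1 /= shuf1r.
Qed.

(** The expansion [shuf_posE] is applied behind the first letter. It is legitimate there because
    tensors in the image of [sig12] have a nonempty rest behind that letter. *)
Lemma tlmap_shuf_sig12 t x : t \in posdeg A -> tlmap (shuf t) (sig12 x) =
  tlmap (tlmap (shuf t)) (sig12 x) + tlmap (succs t) (sig12 x) +
  tlmap mul12 (tlmap (tlmap (succs t)) (sig12 x)).
Proof.
move=> t0; move: x; apply: (sig12_ext (f := tlmap (shuf t))
  (g := fun z => tlmap (tlmap (shuf t)) z + tlmap (succs t) z +
    tlmap mul12 (tlmap (tlmap (succs t)) z))).
- exact: tlmap_linear.
- apply: linear_add; last by move=> k u v; rewrite !tlmap_linear.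
  by apply: linear_add; exact: tlmap_linear.
move=> a b x; rewrite !tlmap_cons /= shuf_posE ?lcons_posdeg // /shuf_parts.
by rewrite !linearDr.
Qed.

(** The summands come from the parts [<], [>] and [.] of the shuffle behind the first letter. They
    are the shape in which [front_shuf] meets its right-hand side. *)
Lemma succs_sig12_cons t a x : succs (sig12 t) (lcons a x) =
  sig12 (lcons a (succs (sig12 t) x)) + succ2 (sig12 t) (lcons a x) +
  tlmap mul12 (sig12 (lcons a (succ2 (sig12 t) x))).
Proof.
move: t; apply: (sig12_ext (f := succs ^~ (lcons a x))
  (g := fun t => sig12 (lcons a (succs t x)) + succ2 t (lcons a x) +
    tlmap mul12 (sig12 (lcons a (succ2 t x))))).
- by move=> k u v; exact: succs_linearl.
- apply: linear_add; last by move=> k u v; rewrite succ2_linearl !opL.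
  by apply: linear_add => k u v; [rewrite succs_linearl !opL|exact: succ2_linearl].
move=> d e t; set t' := lcons e t.
rewrite succs_cons front_cons tlmap_shuf_sig12 ?lcons_posdeg // !tlmap2_sig12 !tlmap_cons /=.
by rewrite -succs_cons -!succ2_cons -front_cons -succ2_cons.
Qed.

Lemma front_mul12 c a z : z \in posdeg A ->
  front c (mul12 (lcons a z)) = tlmap mul12 (sig12 (lcons a (front c z))).
Proof.
move: z; apply: posdeg_ext => [k u v|k u v|b u]; rewrite ?opL //.
by rewrite mul12_cons !front_cons -mul12_cons -(sig12_mul12 brA) tlmap_cons.
Qed.

Lemma front_succs c b y : (forall x, front c (shuf y x) = succs (front c y) x) ->
  forall x, front c (succs (lcons b y) x) = succ2 (front c (lcons b y)) x.
Proof.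
move=> ih x; rewrite succs_cons front_pos ?tlmap_posdeg //.
by rewrite (tlmap_compE (h := succs (front c y))) // -succ2_cons -succ2_sig12 front_cons.
Qed.

Lemma frontD c x y : front c (x + y) = front c x + front c y.
Proof. exact: raddfD. Qed.

(** Outer induction on the right factor, inner induction on the left. Of the three summands of
    [shuf_parts], the first uses the inner hypothesis, the second [front_succs] with the outer one,
    the third [front_mul12] followed by [front_succs]; they match the summands of [succs_sig12_cons]
    in order. *)
Lemma front_shuf c y x : front c (shuf y x) = succs (front c y) x.
Proof.
move: y x; suff W v x : front c (shuf (tens v) x) = succs (front c (tens v)) x.
  move=> y x; move: y; apply: tensalg_ext => [k u v|k u v|//].
    by rewrite shuf_linearl front_linear.
  by rewrite front_linear succs_linearl.
elim: v x => [|b v ihv] x.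
  by rewrite shuf1l front_one tens_cons succs_cons tlmap_shuf_one ?front_posdeg.
have bTh := front_succs b ihv; rewrite -tens_cons in bTh.
move: x; apply: tensalg_ext => [k u w|k u w|]; rewrite ?opL //.
elim=> [|a u ihu]; first by rewrite shuf1r succs_tone ?front_posdeg.
have Thpos z : succs (tens (b :: v)) z \in posdeg A.
  by rewrite tens_cons succs_cons tlmap_posdeg.
rewrite (tens_cons a) shuf_posE ?lcons_posdeg ?tens_posdeg // /shuf_parts !frontD.
rewrite !tlmap_cons /= front_cons ihu bTh (front_mul12 _ _ (Thpos _)) bTh.
by rewrite [tens (b :: v)]tens_cons front_cons succs_sig12_cons.
Qed.

(** * Conditional forms of the axioms, usable inside the induction that proves associativity *)

Lemma succs_consR b y z : (forall x, shuf z (shuf y x) = shuf (shuf z y) x) ->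
  forall x, succs (lcons b (shuf z y)) x = tlmap (shuf z) (succs (lcons b y) x).
Proof. by move=> yz x; rewrite !succs_cons (tlmap_compE (h := shuf (shuf z y))). Qed.

Lemma succs_tlmap_shuf z : (forall y x, shuf z (shuf y x) = shuf (shuf z y) x) ->
  forall t x, succs (tlmap (shuf z) t) x = tlmap (shuf z) (succs t x).
Proof.
move=> zA t x; move: t; apply: tcons_ext => [k u v|k u v||b y].
- by rewrite tlmap_linear succs_linearl.
- by rewrite succs_linearl tlmap_linear.
- by rewrite tlmap_one succs0 succs_one tlmap0.
by rewrite tlmap_cons succs_consR.
Qed.

(** The axiom (x * y) > z = x > (y > z) for the right factor c (x) z: [front_shuf] carries c through
    the shuffle, and associativity for the shorter z does the rest behind c. *)
Lemma succs_cons_shuf c z : (forall y x, shuf z (shuf y x) = shuf (shuf z y) x) ->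
  forall y x, succs (lcons c z) (shuf y x) = succs (succs (lcons c z) y) x.
Proof. by move=> zA y x; rewrite !(succs_cons m s c) front_shuf succs_tlmap_shuf. Qed.

(** * Products with a right factor z for which (x * y) > z = x > (y > z) *)

Section TripleProducts.
Variable z : T.
Hypothesis succs_shuf : forall y x, succs z (shuf y x) = succs (succs z y) x.

(** In x > (y . z) the product heading the right factor leaves by [succs_mul12]; behind the first
    letter what remains is the hypothesis on z. *)
Lemma succs_dot y x : succs (mul12 (tlmap (succs z) y)) x = mul12 (tlmap (succs z) (succs y x)).
Proof.
move: y; apply: tcons_ext => [k u v|k u v||b y].
- by rewrite !opL succs_linearl.
- by rewrite succs_linearl !opL.
- by rewrite tlmap_one mul12_0 succs0 succs_one tlmap0 mul12_0.
rewrite tlmap_cons /= succs_mul12 succ2_cons succs_cons; congr (mul12 _).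
by rewrite (tlmap_compE (h := succs (succs z y))) // => u; exact: succs_shuf.
Qed.

Lemma dot_prec y x :
  mul12 (tlmap (succs z) (tlmap (shuf y) x)) = mul12 (tlmap (succs (succs z y)) x).
Proof. by rewrite (tlmap_compE (h := succs (succs z y))) // => u; exact: succs_shuf. Qed.

(** Associativity of m on the leading letters, with [succs_dot] applied behind the first letter of
    x. *)
Lemma dot_dot y x : mul12 (tlmap (succs z) (mul12 (tlmap (succs y) x))) =
  mul12 (tlmap (succs (mul12 (tlmap (succs z) y))) x).
Proof.
rewrite tlmap_mul12 -(mul12_tlmap_mul12 brA); congr (mul12 _).
rewrite -[RHS](tlmap_compE (f := mul12) (g := tlmap (succs z) \o succs y)) => [|u]; last first.
  by rewrite /= succs_dot.
by congr (tlmap _ _); exact: tlmap_comp.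
Qed.
End TripleProducts.

Lemma tlmap_shuf_dot y z :
  (forall x, succs (tlmap (shuf z) y) x = tlmap (shuf z) (succs y x)) ->
  forall x, tlmap (shuf z) (mul12 (tlmap (succs y) x)) = mul12 (tlmap (succs (tlmap (shuf z) y)) x).
Proof.
move=> ThR x; rewrite tlmap_mul12; congr (mul12 _).
by rewrite (tlmap_compE (h := succs (tlmap (shuf z) y))) // => u; rewrite /= ThR.
Qed.

(** * Associativity of the quasi-shuffle product *)

Lemma succs_posdeg y x : succs y x \in posdeg A.
Proof.
rewrite posdegE; apply/eqP; move: y; apply: tcons_ext => [k u v|k u v||b y].
- by rewrite succs_linearl tdeg_linear.
- by rewrite scaler0 addr0.
- by rewrite succs_one linear0.
by rewrite succs_cons; apply/eqP; rewrite -posdegE tlmap_posdeg.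
Qed.

Lemma shuf_posdeg y x : y \in posdeg A -> x \in posdeg A -> shuf y x \in posdeg A.
Proof.
move=> y0 x0; rewrite (shuf_posE _ _ y0 x0) /shuf_parts.
apply: rpredD; last exact: mul12_posdeg.
by apply: rpredD; [exact: tlmap_posdeg|exact: succs_posdeg].
Qed.

Lemma tlmapD (f : {linear T -> T}) x y : tlmap f (x + y) = tlmap f x + tlmap f y.
Proof. exact: raddfD. Qed.

Lemma mul12D x y : mul12 (x + y) = mul12 x + mul12 y. Proof. exact: raddfD. Qed.

Lemma succsDl x y z : succs (y + z) x = succs y x + succs z x.
Proof. by have := succs_linearl m s x 1 y z; rewrite !scale1r. Qed.

Lemma tlmap_succsDl x y z : tlmap (succs (y + z)) x = tlmap (succs y) x + tlmap (succs z) x.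
Proof. by have := tlmap_succs_linearl m s x 1 y z; rewrite !scale1r. Qed.

(** Three nested inductions on words, z outermost, then y, then x. The hypothesis on z holds for all
    y and x and yields x > (y > z), x > (y . z), x . (y > z) and x . (y . z); the one on y holds for
    all x and yields x > (y < z) and x . (y < z); the one on x yields x < (y * z). *)
Lemma shufA z y x : shuf z (shuf y x) = shuf (shuf z y) x.
Proof.
suff W w y' x' : shuf (tens w) (shuf y' x') = shuf (shuf (tens w) y') x'.
  move: z; apply: tensalg_ext => [k u v|k u v|//].
    by rewrite shuf_linearl.
  by rewrite !shuf_linearl.
elim: w y' x' => {z y x} [|c w ihw] y x; first by rewrite !shuf1l.
have ThR := succs_cons_shuf c ihw; rewrite -tens_cons in ThR.
set z := tens (c :: w) in ThR *.
suff W v x' : shuf z (shuf (tens v) x') = shuf (shuf z (tens v)) x'.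
  move: y; apply: tensalg_ext => [k u v|k u v|//].
    by rewrite shuf_linearl shuf_linear.
  by rewrite shuf_linear shuf_linearl.
elim: v x' => {y x} [|b v ihv] x; first by rewrite shuf1l shuf1r.
have ThRz := succs_consR b ihv; set y := tens (b :: v).
have {}ThRz x' : succs (tlmap (shuf z) y) x' = tlmap (shuf z) (succs y x').
  by rewrite /y tens_cons tlmap_cons ThRz.
move: x; apply: tensalg_ext => [k u v'|k u v'|]; rewrite ?shuf_linear //.
elim=> [|a u ihu]; first by rewrite !shuf1r.
set x := tens (a :: u).
have [z0 y0 x0] : [/\ z \in posdeg A, y \in posdeg A & x \in posdeg A].
  by split; exact: tens_posdeg.
rewrite (shuf_posE m s z0 (shuf_posdeg y0 x0)).
rewrite (shuf_posE m s (shuf_posdeg z0 y0) x0) /shuf_parts ThR.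
(* This is (x * y) < z, split along the three parts of x * y. *)
have -> : tlmap (shuf z) (shuf y x) =
    tlmap (shuf (shuf z y)) x + succs (tlmap (shuf z) y) x
    + mul12 (tlmap (succs (tlmap (shuf z) y)) x).
  rewrite (shuf_posE m s y0 x0) /shuf_parts !tlmapD -ThRz tlmap_shuf_dot //; congr (_ + _ + _).
  by rewrite /x (tens_cons a u) [tlmap (shuf y) _]tlmap_cons !tlmap_cons /= ihu.
rewrite [in mul12 (tlmap (succs z) _)](shuf_posE m s y0 x0) /shuf_parts !tlmapD !mul12D.
rewrite dot_prec // -succs_dot // dot_dot //.
have shufE : shuf z y = tlmap (shuf z) y + succs z y + mul12 (tlmap (succs z) y)
  by rewrite (shuf_posE m s z0 y0).
rewrite [in X in _ = _ + X + _]shufE [in X in _ = _ + _ + X]shufE.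
rewrite !succsDl !tlmap_succsDl !mul12D.
(* The left side groups the seven terms by the outer operation of (x * y) * z, the right side by
   that of x * (y * z). *)
by rewrite !addrA [LHS](ACl (1*2*4*6*3*5*7)).
Qed.
End Associativity.

(** * The tridendriform axioms on T^+ *)

Lemma tplus_bilinear (K : fieldType) (A : lmodType K) (H : tensalg A -> tensalg A -> tensalg A)
    (op : tplus A -> tplus A -> tplus A) :
  (forall x y, op x y = H y x :> tensalg A) -> (forall y, linear (H y)) ->
  (forall x, linear (H^~ x)) -> bilinear_for *:%R *:%R op.
Proof.
move=> opE Hr Hl; have valL k (u v : tplus A) :
  (k *: u + v : tplus A) = k *: (u : tensalg A) + (v : tensalg A) :> tensalg A by [].
split=> [y k u v|x k u v]; apply: val_inj; rewrite [LHS]opE [RHS]valL !opE valL.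
  exact: Hr.
exact: Hl.
Qed.

Theorem theorem2p8 (K : fieldType) (charK : [pchar K] =i pred0)
    (A : lmodType K) (m : {bilinear A -> A -> A})
    (s : {linear tpow A 2 -> tpow A 2})
    (brA : braided_algebra m s) :
  tridendriform (qprec m s) (qsucc m s) (qdot m s).
Proof.
(* The sum of the three operations is the quasi-shuffle product on T^+. *)
have valR (x y : tplus A) :
    val (qprec m s x y + qsucc m s x y + qdot m s x y) = shuf m s (val y) (val x).
  rewrite (shuf_posE m s (valP y) (valP x)) /shuf_parts.
  by rewrite -val_qprec -val_qsucc -val_qdot.
(* With associativity available in full, the axiom extends from c (x) z to every z by linearity; on
   scalars z both sides are 0. *)
have ThR z y x : succs m s z (shuf m s y x) = succs m s (succs m s z y) x.
  move: z; apply: tcons_ext => [k u v|k u v||c z].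
  - exact: succs_linearl.
  - by rewrite !succs_linearl.
  - by rewrite !succs_one succs0.
  by rewrite (succs_cons_shuf brA) // => u v; exact: (shufA brA).
have RTh z t x : succs m s (tlmap (shuf m s z) t) x = tlmap (shuf m s z) (succs m s t x).
  by apply: succs_tlmap_shuf => y x'; exact: (shufA brA).
split.
- apply: (tplus_bilinear (H := fun y x => tlmap (shuf m s y) x) (val_qprec m s)) => [y|].
    exact: tlmap_linear.
  exact: tlmap_shuf_linearl.
- apply: (tplus_bilinear (H := succs m s) (val_qsucc m s)) => [y|x k u v]; first exact: succs_linear.
  exact: succs_linearl.
- apply: (tplus_bilinear (H := fun y x => mul12 m (tlmap (succs m s y) x)) (val_qdot m s))
    => [y|x] k u v /=.
    by rewrite tlmap_linear mul12_linear.
  by rewrite tlmap_succs_linearl mul12_linear.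
- move=> x y z; apply: val_inj; rewrite [LHS]val_qprec [RHS]val_qprec valR val_qprec.
  by apply: tlmap_compE => u; exact: (shufA brA).
- move=> x y z; apply: val_inj; rewrite [LHS]val_qprec [RHS]val_qsucc val_qsucc val_qprec.
  by rewrite RTh.
- move=> x y z; apply: val_inj; rewrite [LHS]val_qsucc [RHS]val_qsucc valR val_qsucc.
  exact: ThR.
- move=> x y z; apply: val_inj; rewrite [LHS]val_qdot [RHS]val_qsucc val_qsucc val_qdot.
  by rewrite (succs_dot brA).
- move=> x y z; apply: val_inj; rewrite [LHS]val_qdot [RHS]val_qdot val_qprec val_qsucc.
  exact: dot_prec.
- move=> x y z; apply: val_inj; rewrite [LHS]val_qprec [RHS]val_qdot val_qdot val_qprec.
  exact: tlmap_shuf_dot.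
- move=> x y z; apply: val_inj; rewrite [LHS]val_qdot [RHS]val_qdot !val_qdot.
  exact: dot_dot.
Qed.
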